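(* Let $\rho$ be an $n$-qubit state with $S_2(\rho)=O(\log n)$, where for a given bipartition of the qubits into complementary subsystems $A$ and $B$ it is promised that either (a) $\mathcal{E}(\rho)=O(\log n)$ and $D_{\mathrm F}(\rho)=O(\log n)$, or (b) $\mathcal{E}(\rho)=\omega(\log n)$ and $D_{\mathrm F}(\rho)=\omega(\log n)$. Then there exists an efficient quantum algorithm that distinguishes case (a) from case (b) using $\mathrm{poly}(n)$ copies of $\rho$ with high probability.
   Context: All states are density matrices on $(\mathbb{C}^2)^{\otimes n}$; asymptotic statements refer to families of states indexed by $n\to\infty$, with the implied constants in $O(\cdot)$ and the growth function in $\omega(\log n)$ fixed for the promise. ''Efficient'' means running in time polynomial in $n$. The $2$-Rényi entropy is $S_2(\rho)=-\ln \mathrm{tr}(\rho^2)$. The partial transpose on subsystem $B$ is the linear map with $(X_A\otimes Y_B)^{\Gamma}=X_A\otimes Y_B^{T}$ (transpose in the computational basis). The PT negativity (logarithmic negativity) is $\mathcal{E}(\rho)=\ln\|\rho^{\Gamma}\|_1$, where $\|\cdot\|_1$ is the trace norm. The fidelity of separability is $D_{\mathrm F}(\rho)=\min_{\sigma\in \mathrm{SEP}}-\ln\mathcal{F}(\rho,\sigma)$, where SEP is the set of states separable with respect to $A|B$ and $\mathcal{F}(\rho,\sigma)=\big(\mathrm{tr}\sqrt{\sqrt{\rho}\,\sigma\sqrt{\rho}}\big)^2$ is the Uhlmann fidelity. *)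

(* Defs.v *)
From HB Require Import structures.
From mathcomp Require Import all_boot all_order all_algebra.
From mathcomp Require Import sesquilinear spectral complex.
From mathcomp Require Import all_classical all_reals all_analysis.
Set Implicit Arguments.
Unset Strict Implicit.
Unset Printing Implicit Defensive.
Import Order.TTheory GRing.Theory Num.Theory.
Import numFieldNormedType.Exports.
Local Open Scope classical_set_scope.
Local Open Scope ring_scope.
Local Open Scope complex_scope.
Local Open Scope sesquilinear_scope.

(* Qubits are labelled by a finite type T ('I_n for n qubits, a subtype of
   'I_n for a subsystem).  The computational basis of (C^2)^{(x) T} is the set
   of bit strings indexed by T, so operators are matrices of size
   #|bits T| = 2 ^ #|T|, read and built through [entry] and [opmx]. *)
Definition bits (T : finType) := {ffun T -> bool}.

Notation operator R T := 'M[R[i]]_#|bits T|.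

Definition entry (R : realType) (T : finType) (M : operator R T)
  (x y : bits T) : R[i] := M (enum_rank x) (enum_rank y).

Definition opmx (R : realType) (T : finType) (F : bits T -> bits T -> R[i]) :
  operator R T := \matrix_(i, j) F (enum_val i) (enum_val j).

(* The order of R[i] makes 0 <= z entail that z is real, so that the first
   condition says "Hermitian and positive semidefinite". *)
Definition density (R : realType) N (rho : 'M[R[i]]_N) : Prop :=
  (forall v : 'rV[R[i]]_N, 0 <= (v *m rho *m v ^t*) 0 0) /\ \tr rho = 1.

(* Meant for positive semidefinite M (spectral_diag is 0 if M is not normal). *)
Definition sqrtmx (R : realType) N (M : 'M[R[i]]_N) : 'M[R[i]]_N :=
  invmx (spectralmx M) *m diag_mx (map_mx sqrtC (spectral_diag M))
    *m spectralmx M.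

Definition trace_norm (R : realType) N (M : 'M[R[i]]_N) : R :=
  complex.Re (\tr (sqrtmx (M ^t* *m M))).

Definition fidelity (R : realType) N (rho sigma : 'M[R[i]]_N) : R :=
  complex.Re (\tr (sqrtmx (sqrtmx rho *m sigma *m sqrtmx rho))) ^+ 2.

Definition renyi2 (R : realType) N (rho : 'M[R[i]]_N) : R :=
  - ln (complex.Re (\tr (rho *m rho))).

(* A bipartition of the n qubits is given by A : {set 'I_n}, with B := ~: A. *)

Definition splice n (A : {set 'I_n}) (x y : bits 'I_n) : bits 'I_n :=
  [ffun i => if i \in A then x i else y i].

(* <x_A x_B| X (x) Y^T |y_A y_B> = <x_A y_B| X (x) Y |y_A x_B>. *)
Definition partial_transpose (R : realType) n (A : {set 'I_n})
  (M : operator R 'I_n) : operator R 'I_n :=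
  opmx (fun x y => entry M (splice A x y) (splice A y x)).

Definition negativity (R : realType) n (A : {set 'I_n})
  (rho : operator R 'I_n) : R :=
  ln (trace_norm (partial_transpose A rho)).

Definition subsystem n (A : {set 'I_n}) : finType := {i : 'I_n | i \in A}.

Definition restrict n (A : {set 'I_n}) (x : bits 'I_n) : bits (subsystem A) :=
  [ffun i => x (val i)].

Definition tensor (R : realType) n (A : {set 'I_n})
  (X : operator R (subsystem A)) (Y : operator R (subsystem (~: A))) :
  operator R 'I_n :=
  opmx (fun x y => entry X (restrict A x) (restrict A y) *
                   entry Y (restrict (~: A) x) (restrict (~: A) y)).

Definition separable (R : realType) n (A : {set 'I_n})
  (sigma : operator R 'I_n) : Prop :=
  exists (r : nat) (p : 'I_r -> R)
         (alpha : 'I_r -> operator R (subsystem A))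
         (beta : 'I_r -> operator R (subsystem (~: A))),
    [/\ forall j, 0 <= p j, \sum_j p j = 1,
        forall j, density (alpha j), forall j, density (beta j) &
        sigma = \sum_j (p j)%:C *: tensor (alpha j) (beta j)].

(* The minimum over SEP, written as an infimum of extended reals because
   - ln F = +oo on the states sigma with F (rho, sigma) = 0. *)
Definition fidelity_of_separability (R : realType) n (A : {set 'I_n})
  (rho : operator R 'I_n) : \bar R :=
  ereal_inf [set (- lne (fidelity rho sigma)%:E)%E |
             sigma in [set sigma | separable A sigma]].

(* Machine model: a random access machine with unit-cost addition and
   subtraction (polynomially equivalent to Turing machines), which controls a
   quantum memory through a finite universal gate set, measurements in the
   computational basis, and requests for fresh copies of the unknown state.
   Registers and memory cells hold natural numbers; r, a, q range over register
   names, and q, q1, q2, q3 are registers holding the address of a qubit. *)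
Inductive instr : Type :=
| Set_ (r c : nat)             (* r := c *)
| Add (r r1 r2 : nat)          (* r := r1 + r2 *)
| Sub (r r1 r2 : nat)          (* r := r1 - r2, truncated *)
| Read (r a : nat)             (* r := mem[a] *)
| Write (a r : nat)            (* mem[a] := r *)
| Jz (r l : nat)               (* if r = 0 then goto l *)
| Had (q : nat)
| Tgate (q : nat)
| Cnot (q1 q2 : nat)           (* target q2 *)
| Toffoli (q1 q2 q3 : nat)     (* target q3 *)
| Copy (q : nat)               (* discard the n qubits q, ..., q + n - 1 and put
                                  a fresh copy of the unknown state there *)
| Measure (r q : nat)          (* r := outcome of measuring qubit q *)
| Halt (b : bool).

Definition program := seq instr.

Record config := Config {
  pc : nat; regs : nat -> nat; mem : nat -> nat }.

Definition update (f : nat -> nat) (a v : nat) : nat -> nat :=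
  fun i => if i == a then v else f i.

Definition set_reg (s : config) (r v : nat) : config :=
  Config (pc s).+1 (update (regs s) r v) (mem s).

Definition set_mem (s : config) (a v : nat) : config :=
  Config (pc s).+1 (regs s) (update (mem s) a v).

Definition goto (s : config) (l : nat) : config := Config l (regs s) (mem s).

Section Machine.
Variables (R : realType) (K : nat).

Definition hadamard (a b : bool) : R[i] :=
  ((-1) ^+ (a && b) * (Num.sqrt 2)^-1)%:C.

(* diag (1, exp (i pi / 4)) *)
Definition tphase (a b : bool) : R[i] :=
  if a != b then 0
  else if a then (Num.sqrt 2)^-1 +i* (Num.sqrt 2)^-1 else 1.

Definition gate1 (u : bool -> bool -> R[i]) (q : 'I_K) : operator R 'I_K :=
  opmx (fun x y => if [forall i, (i != q) ==> (x i == y i)]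
                   then u (x q) (y q) else 0).

Definition cflip (cs : {set 'I_K}) (q : 'I_K) (x : bits 'I_K) : bits 'I_K :=
  [ffun i => if i == q then x q (+) [forall j in cs, x j] else x i].

Definition controlled_not (cs : {set 'I_K}) (q : 'I_K) : operator R 'I_K :=
  opmx (fun x y => (x == cflip cs q y)%:R).

Definition apply_gate (U W : operator R 'I_K) : operator R 'I_K :=
  U *m W *m U ^t*.

(* Unnormalized post-measurement state for outcome b on qubit q. *)
Definition project (q : 'I_K) (b : bool) (W : operator R 'I_K) :
  operator R 'I_K :=
  opmx (fun x y => if (x q == b) && (y q == b) then entry W x y else 0).

Definition block n (a : nat) (x : bits 'I_K) : bits 'I_n :=
  [ffun j : 'I_n => if insub (a + j)%N is Some q then x q else false].

Definition overwrite n (a : nat) (z : bits 'I_n) (x : bits 'I_K) : bits 'I_K :=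
  [ffun q : 'I_K => if (a <= q)%N then
                      if insub (q - a)%N is Some j then z j else x q
                    else x q].

(* Partial trace over the qubits a, ..., a + n - 1, then tensor product with
   rho on these qubits. *)
Definition load_copy n (a : nat) (rho : operator R 'I_n) (W : operator R 'I_K) :
  operator R 'I_K :=
  opmx (fun x y => entry rho (block n a x) (block n a y) *
          \sum_(z : bits 'I_n) entry W (overwrite a z x) (overwrite a z y)).

Definition ground : operator R 'I_K :=
  opmx (fun x y => ((x == [ffun=> false]) && (y == [ffun=> false]))%:R).

Definition qubit (s : config) (q : nat) : option 'I_K := insub (regs s q).

(* [run P rho b t m s W] is the probability weight with which the program P,
   started in classical configuration s and (unnormalized) quantum state W on K
   qubits, executes [Halt b] within t steps while using at most m copies of rho.
   Executing an ill-addressed instruction, or exceeding a resource, aborts the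
   computation without output (weight 0). *)
Fixpoint run (P : program) n (rho : operator R 'I_n) (b : bool) (t m : nat)
    (s : config) (W : operator R 'I_K) {struct t} : R[i] :=
  if t is t'.+1 then
    let val := regs s in
    let next := goto s (pc s).+1 in
    if onth P (pc s) is Some ins then
      match ins with
      | Set_ r c => run P rho b t' m (set_reg s r c) W
      | Add r r1 r2 => run P rho b t' m (set_reg s r (val r1 + val r2)%N) W
      | Sub r r1 r2 => run P rho b t' m (set_reg s r (val r1 - val r2)%N) W
      | Read r a => run P rho b t' m (set_reg s r (mem s (val a))) W
      | Write a r => run P rho b t' m (set_mem s (val a) (val r)) W
      | Jz r l => run P rho b t' m (if val r == 0%N then goto s l else next) W
      | Had q =>
          if qubit s q is Some j
          then run P rho b t' m next (apply_gate (gate1 hadamard j) W) else 0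
      | Tgate q =>
          if qubit s q is Some j
          then run P rho b t' m next (apply_gate (gate1 tphase j) W) else 0
      | Cnot q1 q2 =>
          if (qubit s q1, qubit s q2) is (Some j1, Some j2) then
            if j1 != j2 then
              run P rho b t' m next (apply_gate (controlled_not [set j1]%SET j2) W)
            else 0
          else 0
      | Toffoli q1 q2 q3 =>
          if (qubit s q1, qubit s q2, qubit s q3)
             is (Some j1, Some j2, Some j3) then
            if uniq [:: j1; j2; j3] then
              run P rho b t' m next
                (apply_gate (controlled_not [set j1; j2]%SET j3) W)
            else 0
          else 0
      | Copy q =>
          if m is m'.+1 then
            if (val q + n <= K)%N
            then run P rho b t' m' next (load_copy (val q) rho W) else 0
          else 0
      | Measure r q =>
          if qubit s q is Some j
          then run P rho b t' m (set_reg s r 0) (project j false W) +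
               run P rho b t' m (set_reg s r 1) (project j true W)
          else 0
      | Halt b' => if b' == b then \tr W else 0
      end
    else 0
  else 0.

End Machine.

(* The input (n, A): register 0 holds n and memory cell i < n tells whether
   qubit i belongs to A; everything else is 0. *)
Definition input n (A : {set 'I_n}) : config :=
  Config 0 (update (fun=> 0%N) 0 n)
    (fun i => if insub i is Some j then nat_of_bool (j \in A) else 0%N).

(* Probability of output b on input (n, A) and unknown state rho, with at most
   B steps, B copies of rho and B qubits of memory, initially in |0...0>. *)
Definition output_prob (R : realType) (P : program) (B : nat) n
  (A : {set 'I_n}) (rho : operator R 'I_n) (b : bool) : R :=
  complex.Re (run P rho b B B (input A) (ground R B)).

Definition poly_bound (c d n : nat) : nat := (c * n ^ d + c)%N.

(* On every input and for every state, P halts with certainty within the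
   polynomial budget. *)
Definition runs_within (R : realType) (P : program) (B : nat -> nat) : Prop :=
  forall n (A : {set 'I_n}) (rho : operator R 'I_n), density rho ->
    output_prob P (B n) A rho true + output_prob P (B n) A rho false = 1.

(* Main.v *)
Require Import Defs.
From HB Require Import structures.
From mathcomp Require Import all_boot all_order all_algebra.
From mathcomp Require Import sesquilinear spectral complex.
From mathcomp Require Import all_classical all_reals all_analysis.
From mathcomp Require Import ring lra zify.
Set Implicit Arguments.
Unset Strict Implicit.
Unset Printing Implicit Defensive.
Import Order.TTheory GRing.Theory Num.Theory.
Import numFieldNormedType.Exports.
Local Open Scope classical_set_scope.
Local Open Scope ring_scope.

(* Let X be the partial transpose of rho. The moment p = tr X^4 separates the
   two cases. With |x_i| the absolute values of the eigenvalues of X, Hoelder's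
   inequality gives (sum x_i^2)^3 <= (sum |x_i|)^2 (sum x_i^4), where
   sum x_i^2 = tr rho^2; hence -ln p <= 2 E(rho) + 3 S_2(rho), and p is at least
   an inverse polynomial in case (a).
   Conversely p <= max x_i^2. If X v = x v with v a unit vector, then
   x = tr (rho Z) for an operator Z such that Z Z^* is a product of two density
   matrices, so x^2 <= tr (rho sigma) <= F (rho, sigma) for this product state
   sigma by the Cauchy-Schwarz inequality; hence p <= exp (- D_F(rho)), which is
   superpolynomially small in case (b).
   Finally p = tr (rho^(x)4 U), where U permutes the four copies cyclically, in
   one direction on A and in the other direction on B. A Hadamard test for U
   with an ancilla measured before and after it, whatever its initial state,
   gives two equal outcomes with probability (1 + p) / 2, and Chebyshev's
   inequality bounds the error of counting these events in n^(e1 + e2) trials. *)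

(** * Execution of programs *)

(** Quantifying over all larger budgets makes [t] and [m] upper bounds, so that branches of
    different cost can be padded to a common bound and the final polynomial budget only has to
    dominate it. *)
Definition outputs (R : realType) (K : nat) (P : program) n
    (rho : operator R 'I_n) (b : bool) (t m : nat) (s : config)
    (W : operator R 'I_K) (v : R[i]) : Prop :=
  forall t' m', (t <= t')%N -> (m <= m')%N -> run P rho b t' m' s W = v.

Section Steps.
Variables (R : realType) (K : nat) (P : program) (n : nat).
Variables (rho : operator R 'I_n) (b : bool).
Implicit Types (W : operator R 'I_K) (v : R[i]) (rg mm : nat -> nat).
Notation outputs := (@outputs R K P n rho b).

Lemma outputs_weaken t m t' m' s W v :
  (t <= t')%N -> (m <= m')%N -> outputs t m s W v -> outputs t' m' s W v.
Proof. by move=> tt' mm' H u p tu mp; apply: H; apply: leq_trans; eassumption. Qed.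

Lemma outputs_set t m p rg mm W v r c : onth P p = Some (Set_ r c) ->
  outputs t m (Config p.+1 (update rg r c) mm) W v ->
  outputs t.+1 m (Config p rg mm) W v.
Proof. by move=> Pp H [//|t'] m' tt' mm' /=; rewrite Pp; apply: H. Qed.

Lemma outputs_add t m p rg mm W v c r r1 r2 : onth P p = Some (Add r r1 r2) ->
  (rg r1 + rg r2)%N = c ->
  outputs t m (Config p.+1 (update rg r c) mm) W v ->
  outputs t.+1 m (Config p rg mm) W v.
Proof. by move=> Pp <- H [//|t'] m' tt' mm' /=; rewrite Pp; apply: H. Qed.

Lemma outputs_sub t m p rg mm W v c r r1 r2 : onth P p = Some (Defs.Sub r r1 r2) ->
  (rg r1 - rg r2)%N = c ->
  outputs t m (Config p.+1 (update rg r c) mm) W v ->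
  outputs t.+1 m (Config p rg mm) W v.
Proof. by move=> Pp <- H [//|t'] m' tt' mm' /=; rewrite Pp; apply: H. Qed.

Lemma outputs_read t m p rg mm W v c r a : onth P p = Some (Read r a) ->
  mm (rg a) = c ->
  outputs t m (Config p.+1 (update rg r c) mm) W v ->
  outputs t.+1 m (Config p rg mm) W v.
Proof. by move=> Pp <- H [//|t'] m' tt' mm' /=; rewrite Pp; apply: H. Qed.

Lemma outputs_jump t m p rg mm W v r l : onth P p = Some (Jz r l) ->
  rg r = 0%N -> outputs t m (Config l rg mm) W v ->
  outputs t.+1 m (Config p rg mm) W v.
Proof.
by move=> Pp r0 H [//|t'] m' tt' mm' /=; rewrite Pp /= r0 eqxx; apply: H.
Qed.

Lemma outputs_nojump t m p rg mm W v r l : onth P p = Some (Jz r l) ->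
  rg r != 0%N -> outputs t m (Config p.+1 rg mm) W v ->
  outputs t.+1 m (Config p rg mm) W v.
Proof.
move=> Pp r0 H [//|t'] m' tt' mm' /=; rewrite Pp /= (negPf r0).
exact: H.
Qed.

Lemma outputs_had t m p rg mm W v q (j : 'I_K) : onth P p = Some (Had q) ->
  rg q = j ->
  outputs t m (Config p.+1 rg mm) (apply_gate (gate1 (@hadamard R) j) W) v ->
  outputs t.+1 m (Config p rg mm) W v.
Proof.
move=> Pp qj H [//|t'] m' tt' mm' /=; rewrite Pp /qubit /= qj valK.
exact: H.
Qed.

Lemma outputs_cnot t m p rg mm W v q1 q2 (j1 j2 : 'I_K) :
  onth P p = Some (Cnot q1 q2) -> rg q1 = j1 -> rg q2 = j2 -> j1 != j2 ->
  outputs t m (Config p.+1 rg mm)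
    (apply_gate (controlled_not R [set j1]%SET j2) W) v ->
  outputs t.+1 m (Config p rg mm) W v.
Proof.
move=> Pp q1j q2j j12 H [//|t'] m' tt' mm' /=.
by rewrite Pp /qubit /= q1j q2j !valK j12; apply: H.
Qed.

Lemma outputs_toffoli t m p rg mm W v q1 q2 q3 (j1 j2 j3 : 'I_K) :
  onth P p = Some (Toffoli q1 q2 q3) ->
  rg q1 = j1 -> rg q2 = j2 -> rg q3 = j3 -> uniq [:: j1; j2; j3] ->
  outputs t m (Config p.+1 rg mm)
    (apply_gate (controlled_not R [set j1; j2]%SET j3) W) v ->
  outputs t.+1 m (Config p rg mm) W v.
Proof.
rewrite [uniq _]/= => Pp q1j q2j q3j j123 H [//|t'] m' tt' mm' /=.
by rewrite Pp /qubit /= q1j q2j q3j !valK j123; apply: H.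
Qed.

Lemma outputs_copy t m p rg mm W v q a : onth P p = Some (Copy q) ->
  rg q = a -> (a + n <= K)%N ->
  outputs t m (Config p.+1 rg mm) (load_copy a rho W) v ->
  outputs t.+1 m.+1 (Config p rg mm) W v.
Proof.
move=> Pp <- qK H [//|t'] [//|m'] tt' mm' /=; rewrite Pp qK.
exact: H.
Qed.

Lemma outputs_measure t m p rg mm W v0 v1 r q (j : 'I_K) :
  onth P p = Some (Defs.Measure r q) -> rg q = j ->
  outputs t m (Config p.+1 (update rg r 0) mm) (project j false W) v0 ->
  outputs t m (Config p.+1 (update rg r 1) mm) (project j true W) v1 ->
  outputs t.+1 m (Config p rg mm) W (v0 + v1).
Proof.
move=> Pp qj H0 H1 [//|t'] m' tt' mm' /=; rewrite Pp /qubit /= qj valK.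
by rewrite H0 ?H1.
Qed.

Lemma outputs_halt m p rg mm W b' : onth P p = Some (Halt b') ->
  outputs 1 m (Config p rg mm) W (if b' == b then \tr W else 0).
Proof. by move=> Pp [//|t'] m' _ _ /=; rewrite Pp. Qed.

End Steps.

(** * Gates and copies of the unknown state *)

Section Entries.
Variables (R : realType) (T : finType).
Implicit Types (M N : operator R T) (x y : bits T).

Lemma entry_opmx (F : bits T -> bits T -> R[i]) x y :
  entry (opmx F) x y = F x y.
Proof. by rewrite /entry mxE !enum_rankK. Qed.

Lemma sum_bits (F : 'I_#|bits T| -> R[i]) :
  \sum_i F i = \sum_(x : bits T) F (enum_rank x).
Proof.
by rewrite (reindex (@enum_rank (bits T))) //; exact/onW_bij/enum_rank_bij.
Qed.

Lemma entry_mul M N x y :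
  entry (M *m N) x y = \sum_z entry M x z * entry N z y.
Proof. by rewrite /entry mxE sum_bits. Qed.

Lemma entry_adj M x y : entry (M ^t*)%sesqui x y = (entry M y x)^*.
Proof. by rewrite /entry !mxE. Qed.

Lemma trace_entry M : \tr M = \sum_x entry M x x.
Proof. by rewrite /mxtrace sum_bits. Qed.

Lemma entryP M N : (forall x y, entry M x y = entry N x y) -> M = N.
Proof.
move=> MN; apply/matrixP => i j.
by have := MN (enum_val i) (enum_val j); rewrite /entry !enum_valK.
Qed.

End Entries.

Section Gates.
Variables (R : realType) (K : nat).
Implicit Types (W : operator R 'I_K) (x y : bits 'I_K) (q : 'I_K).

Definition setbit q (a : bool) x : bits 'I_K :=
  [ffun i => if i == q then a else x i].

Lemma entry_gate (U W : operator R 'I_K) x y :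
  entry (apply_gate U W) x y =
  \sum_u \sum_v entry U x u * entry W u v * (entry U y v)^*.
Proof.
rewrite /apply_gate entry_mul exchange_big /=; apply: eq_bigr => v _.
rewrite entry_mul entry_adj big_distrl /=.
by apply: eq_bigr.
Qed.

Lemma cflipK (cs : {set 'I_K}) q : q \notin cs -> involutive (cflip cs q).
Proof.
move=> qcs x; apply/ffunP => i; rewrite !ffunE.
have -> : [forall j in cs, cflip cs q x j] = [forall j in cs, x j].
  apply: eq_forallb => j; rewrite ffunE.
  by case: eqP => // ->; rewrite (negPf qcs).
by rewrite eqxx; case: eqP => // ->; rewrite addbK.
Qed.

(** A controlled NOT permutes the basis strings by an involution, so conjugation by it merely
    relabels the entries of [W]. *)
Lemma entry_cnot (cs : {set 'I_K}) q W x y : q \notin cs ->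
  entry (apply_gate (controlled_not R cs q) W) x y =
  entry W (cflip cs q x) (cflip cs q y).
Proof.
move=> qcs; rewrite entry_gate.
have E z u : entry (controlled_not R cs q) z u = (u == cflip cs q z)%:R.
  rewrite entry_opmx; congr (nat_of_bool _)%:R.
  by apply/eqP/eqP => ->; rewrite cflipK.
rewrite (bigD1 (cflip cs q x)) //= [X in _ + X]big1 ?addr0; last first.
  by move=> u /negPf ux; apply: big1 => v _; rewrite E ux !mul0r.
rewrite (bigD1 (cflip cs q y)) //= [X in _ + X]big1 ?addr0; last first.
  by move=> u /negPf ux; rewrite !E ux rmorph0 mulr0.
by rewrite !E !eqxx rmorph_nat mul1r mulr1.
Qed.

Lemma sum_setbit q x (F : bits 'I_K -> R[i]) :
  \sum_(u : bits 'I_K | [forall i, (i != q) ==> (x i == u i)]) F u =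
  \sum_a F (setbit q a x).
Proof.
rewrite (reindex_onto (fun a => setbit q a x) (fun u : bits 'I_K => u q)) /=.
  apply: eq_bigl => a; rewrite ffunE !eqxx andbT.
  by apply/forallP => i; rewrite ffunE; case: eqP => //= _; rewrite eqxx.
move=> u /forallP xu; apply/ffunP => i; rewrite ffunE.
by have := xu i; case: eqP => [->|_ /= /eqP].
Qed.

Lemma entry_gate1 h q W x y :
  entry (apply_gate (gate1 h q) W) x y =
  \sum_a \sum_b h (x q) a * entry W (setbit q a x) (setbit q b y) *
    (h (y q) b)^*.
Proof.
rewrite entry_gate.
transitivity (\sum_(u : bits 'I_K | [forall i, (i != q) ==> (x i == u i)])
    \sum_(v : bits 'I_K | [forall i, (i != q) ==> (y i == v i)])
    h (x q) (u q) * entry W u v * (h (y q) (v q))^*).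
  rewrite [RHS]big_mkcond; apply: eq_bigr => u _.
  rewrite /gate1 !entry_opmx; case: ifP => _; last first.
    by apply: big1 => v _; rewrite !mul0r.
  rewrite [RHS]big_mkcond; apply: eq_bigr => v _.
  by rewrite entry_opmx; case: ifP => // _; rewrite rmorph0 mulr0.
rewrite sum_setbit; apply: eq_bigr => a _.
by rewrite sum_setbit; apply: eq_bigr => b _; rewrite !ffunE !eqxx.
Qed.

Lemma hadamard_conj a b : (hadamard R a b)^* = hadamard R a b.
Proof. exact: conjc_real. Qed.

Lemma trace_project q W :
  \tr (project q false W) + \tr (project q true W) = \tr W.
Proof.
rewrite !trace_entry -big_split; apply: eq_bigr => x _ /=.
by rewrite !entry_opmx andbb; case: (x q); rewrite ?addr0 ?add0r.
Qed.

End Gates.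

Section BitPositions.
Variable K : nat.
Implicit Types (x y : bits 'I_K).

(* Reading a bit string at a natural number position, [false] out of range,
   turns identities between bit strings into linear arithmetic. *)
Definition bitat x (p : nat) : bool :=
  if insub p is Some r then x r else false.

Lemma bitatE x (r : 'I_K) : bitat x r = x r.
Proof. by rewrite /bitat valK. Qed.

Lemma bitat_out x p : (K <= p)%N -> bitat x p = false.
Proof. by move=> Kp; rewrite /bitat insubN // -leqNgt. Qed.

Lemma bitatP x y : (forall p, (p < K)%N -> bitat x p = bitat y p) -> x = y.
Proof. by move=> xy; apply/ffunP => r; rewrite -!bitatE xy. Qed.

Lemma bitat_setbit q a x p :
  bitat (setbit q a x) p = if p == q then a else bitat x p.
Proof.
case: (ltnP p K) => pK; last first.
  by rewrite !bitat_out // gtn_eqF // (leq_trans _ pK).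
by rewrite -[p]/(val (Ordinal pK)) !bitatE ffunE.
Qed.

End BitPositions.

Lemma bitat_block K n a (x : bits 'I_K) p :
  bitat (block n a x) p = if (p < n)%N then bitat x (a + p)%N else false.
Proof.
case: (ltnP p n) => pn; last by rewrite bitat_out.
by rewrite -[p]/(val (Ordinal pn)) bitatE ffunE.
Qed.

Lemma bitat_overwrite K n a (z : bits 'I_n) (x : bits 'I_K) p :
  bitat (overwrite a z x) p =
  if (p < K)%N && (a <= p < a + n)%N then bitat z (p - a)%N else bitat x p.
Proof.
case: (ltnP p K) => pK; last by rewrite /= !bitat_out.
rewrite -[p]/(val (Ordinal pK)) !bitatE ffunE /=.
case: (leqP a p) => //= ap; rewrite /bitat; case: insubP => [j /= jn _|/= jn].
  by have -> : (p < a + n)%N by lia.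
by have -> : (p < a + n)%N = false by lia.
Qed.

(** Splits on all address comparisons; linear arithmetic refutes the inconsistent cases and matches
    the positions in the others. *)
Ltac bitwise :=
  rewrite ?(bitat_overwrite, bitat_block, bitat_setbit);
  repeat case: ifP; try lia;
  try (move=> *; solve [congr bitat; lia | congr (bitat _ _); lia | lia]).

(** * Loading tensor powers of the unknown state *)

Section Load.
Variables (R : realType) (K n : nat) (rho : operator R 'I_n).
Implicit Types (W : operator R 'I_K) (x y : bits 'I_K).

(** The [m]-fold tensor power of [rho], with factor [c] on the [n] qubits starting at [c * n]. *)
Definition copies m : operator R 'I_(m * n) :=
  opmx (fun u v => \prod_(c < m)
    entry rho (block n (c * n) u) (block n (c * n) v)).

Lemma sum_bits0 (F : bits 'I_0 -> R[i]) u : \sum_z F z = F u.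
Proof.
rewrite (bigD1 u) //= big1 ?addr0 // => z /eqP[].
by apply/ffunP; case.
Qed.

Lemma sum_bits_split m (F : bits 'I_(m.+1 * n) -> R[i]) :
  \sum_z F z = \sum_(v : bits 'I_n) \sum_(u : bits 'I_(m * n))
    F (overwrite (m * n) v (overwrite 0 u [ffun=> false])).
Proof.
rewrite pair_big /=.
rewrite (reindex_onto
  (fun p : bits 'I_n * bits 'I_(m * n) =>
    overwrite (m * n) p.1 (overwrite 0 p.2 [ffun=> false]))
  (fun z : bits 'I_(m.+1 * n) => (block n (m * n) z, block (m * n) 0 z))).
  apply: eq_bigl => -[v u] /=; apply/eqP; congr pair; apply: bitatP => p pK.
    by bitwise.
  by bitwise.
move=> z _ /=; apply: bitatP => p pK; bitwise.
Qed.

Lemma entry_load_copies m W x y :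
  entry (load_copy 0 (copies m) W) x y =
  \prod_(c < m) entry rho (block n (c * n) x) (block n (c * n) y) *
  \sum_(z : bits 'I_(m * n)) entry W (overwrite 0 z x) (overwrite 0 z y).
Proof.
rewrite entry_opmx /copies entry_opmx; congr (_ * _).
apply: eq_bigr => c _.
have E (w : bits 'I_K) :
    block n (c * n) (block (m * n) 0 w) = block n (c * n) w.
  apply: bitatP => p pn.
  rewrite !bitat_block pn; case: ifP => // /negP[].
  rewrite (@leq_trans (c.+1 * n)) // ?leq_mul2r ?ltn_ord ?orbT //.
  by rewrite mulSn addnC ltn_add2r.
by rewrite !E.
Qed.

Lemma load_copies0 W : load_copy 0 (copies 0) W = W.
Proof.
apply: entryP => x y; rewrite entry_load_copies big_ord0 mul1r.
have E (z : bits 'I_0) (w : bits 'I_K) : overwrite 0 z w = w.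
  by apply: bitatP => p pK; bitwise.
rewrite (sum_bits0 _ [ffun=> false]) !E //.
Qed.

(** Successive [Copy] instructions on adjacent blocks load one larger tensor power: their partial
    traces compose, since the sum over [m.+1] blocks splits off the last block. *)
Lemma load_copiesS m W :
  load_copy (m * n) rho (load_copy 0 (copies m) W) =
  load_copy 0 (copies m.+1) W.
Proof.
apply: entryP => x y; rewrite entry_load_copies big_ord_recr /=.
rewrite entry_opmx sum_bits_split -mulrA mulrCA; congr (_ * _).
rewrite big_distrr /=; apply: eq_bigr => v _.
rewrite entry_load_copies; congr (_ * _); last first.
  apply: eq_bigr => u _.
  by congr (entry W _ _); apply: bitatP => p pK; bitwise.
apply: eq_bigr => c _; congr (entry rho _ _); apply: bitatP => p pn.
  rewrite !bitat_block pn bitat_overwrite; case: ifP => // /and3P[_ + _].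
  rewrite leqNgt (@leq_trans (c.+1 * n)) // ?leq_mul2r ?ltn_ord ?orbT //.
  by rewrite mulSn addnC ltn_add2r.
rewrite !bitat_block pn bitat_overwrite; case: ifP => // /and3P[_ + _].
rewrite leqNgt (@leq_trans (c.+1 * n)) // ?leq_mul2r ?ltn_ord ?orbT //.
by rewrite mulSn addnC ltn_add2r.
Qed.

End Load.

(** * The Hadamard test *)

Section Fredkin.
Variables (R : realType) (K : nat).
Implicit Types (W : operator R 'I_K) (x y : bits 'I_K) (p q r : 'I_K).

Lemma cflip1E r p x s :
  cflip [set r]%SET p x s = if s == p then x p (+) x r else x s.
Proof.
rewrite ffunE; case: eqP => // _; congr (_ (+) _).
apply/forallP/idP => [/(_ r)|xr i]; first by rewrite inE eqxx.
by rewrite inE; apply/implyP => /eqP ->.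
Qed.

Lemma cflip2E q p r x s :
  cflip [set q; p]%SET r x s = if s == r then x r (+) (x q && x p) else x s.
Proof.
rewrite ffunE; case: eqP => // _; congr (_ (+) _).
apply/forallP/andP => [H|[xq xp] i]; last first.
  by rewrite !inE; apply/implyP => /orP[] /eqP ->.
by split; [have := H q | have := H p]; rewrite !inE eqxx ?orbT.
Qed.

Definition fredkin q p r x : bits 'I_K :=
  [ffun s => if x q then if s == p then x r else if s == r then x p else x s
             else x s].

(** Three alternating controlled NOTs swap two bits. Controlling only the middle one is enough: when
    it is inactive, the outer two cancel. *)
Lemma fredkin_cflip q p r x : q != p -> q != r -> p != r ->
  cflip [set r]%SET p (cflip [set q; p]%SET r (cflip [set r]%SET p x)) =
  fredkin q p r x.
Proof.
move=> qp qr pr; apply/ffunP => s.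
rewrite !(cflip1E, cflip2E) ffunE !eqxx (eq_sym r p) (negPf qp) ?(negPf qr).
rewrite (negPf pr).
case: (eqVneq s p) => [->|_].
  by rewrite ?(negPf pr); case: (x q); case: (x p); case: (x r).
by case: (eqVneq s r) => [->|_]; case: (x q); case: (x p); case: (x r).
Qed.

Definition cswap q p r W : operator R 'I_K :=
  apply_gate (controlled_not R [set r]%SET p)
    (apply_gate (controlled_not R [set q; p]%SET r)
      (apply_gate (controlled_not R [set r]%SET p) W)).

Lemma entry_cswap q p r W x y : q != p -> q != r -> p != r ->
  entry (cswap q p r W) x y = entry W (fredkin q p r x) (fredkin q p r y).
Proof.
move=> qp qr pr; rewrite /cswap.
have p_r : p \notin [set r]%SET by rewrite inE.
have r_qp : r \notin [set q; p]%SET by rewrite !inE ![r == _]eq_sym negb_or qr.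
by rewrite !entry_cnot // !fredkin_cflip.
Qed.

End Fredkin.

Section HadamardTest.
Variables (R : realType) (K N : nat) (sigma : operator R 'I_N).
Variables (q : 'I_K) (g : bits 'I_N -> bits 'I_N) (G : bits 'I_K -> bits 'I_K).
Hypothesis Nq : (N <= q)%N.
Hypothesis G_block : forall x,
  block N 0 (G x) = if x q then g (block N 0 x) else block N 0 x.
Hypothesis G_out : forall x (r : 'I_K), (N <= r)%N -> G x r = x r.
Hypothesis g_bij : bijective g.
Hypothesis tr_sigma : \tr sigma = 1.
Implicit Types (W : operator R 'I_K) (x y : bits 'I_K) (u z : bits 'I_N).

Let h := @hadamard R.
Let NK : (N <= K)%N. Proof. exact: ltnW (leq_ltn_trans Nq (ltn_ord q)). Qed.

Lemma overwrite_out z x (r : 'I_K) : (N <= r)%N -> overwrite 0 z x r = x r.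
Proof. by move=> Nr; rewrite -!bitatE bitat_overwrite; case: ifP => //; lia. Qed.

Lemma overwrite_q z x : overwrite 0 z x q = x q.
Proof. exact: overwrite_out. Qed.

Lemma block_overwrite z x : block N 0 (overwrite 0 z x) = z.
Proof. by apply: bitatP => p pN; bitwise. Qed.

Lemma block_setbit a x : block N 0 (setbit q a x) = block N 0 x.
Proof. by apply: bitatP => p pN; bitwise. Qed.

(** A string amounts to its first [N] bits and the rest; the strings whose first [N] bits vanish
    serve as representatives of the rest. *)
Lemma sum_overwrite (P : pred (bits 'I_K)) (F : bits 'I_K -> R[i]) :
  (forall z x, P (overwrite 0 z x) = P x) ->
  \sum_(x | P x) F x =
  \sum_(x | P x && (block N 0 x == [ffun=> false]))
    \sum_(z : bits 'I_N) F (overwrite 0 z x).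
Proof.
move=> Pov; rewrite pair_big /=.
rewrite (reindex_onto (fun p : bits 'I_K * bits 'I_N => overwrite 0 p.2 p.1)
  (fun x => (overwrite 0 ([ffun=> false] : bits 'I_N) x, block N 0 x))).
  apply: eq_bigl => -[x z] /=; rewrite Pov block_overwrite andbT.
  congr (_ && _); apply/eqP/eqP => [[E]|E].
    by rewrite -E block_overwrite.
  by congr pair; rewrite -E; apply: bitatP => p pK; bitwise.
by move=> x _ /=; apply: bitatP => p pK; bitwise.
Qed.

Let red W x y := \sum_(z : bits 'I_N) entry W (overwrite 0 z x) (overwrite 0 z y).

(** [red] is a partial trace over the first [N] qubits, so it sees its arguments only through the
    other qubits. *)
Lemma red_out W x y x' y' :
  (forall r : 'I_K, (N <= r)%N -> x r = x' r) ->
  (forall r : 'I_K, (N <= r)%N -> y r = y' r) -> red W x y = red W x' y'.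
Proof.
move=> xx' yy'; apply: eq_bigr => z _; congr (entry W _ _);
  apply/ffunP => r; rewrite !ffunE /=; case: insubP => [//|rN];
  by rewrite ?xx' ?yy' //; lia.
Qed.

Lemma entry_load_had (b : bool) W x y :
  entry (apply_gate (gate1 h q) (load_copy 0 sigma (project q b W))) x y =
  h (x q) b * h (y q) b *
  (entry sigma (block N 0 x) (block N 0 y) *
   red W (setbit q b x) (setbit q b y)).
Proof.
rewrite entry_gate1.
have E a c : entry (load_copy 0 sigma (project q b W)) (setbit q a x)
    (setbit q c y) = if (a == b) && (c == b) then
      entry sigma (block N 0 x) (block N 0 y) *
      red W (setbit q b x) (setbit q b y) else 0.
  rewrite entry_opmx !block_setbit.
  case: ifP => [/andP[/eqP -> /eqP ->]|ab].
    congr (_ * _); apply: eq_bigr => z _.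
    by rewrite entry_opmx !overwrite_q !ffunE !eqxx.
  rewrite big1 ?mulr0 // => z _.
  by rewrite entry_opmx !overwrite_q !ffunE !eqxx ab.
rewrite (bigD1 b) //= [X in _ + X]big1 ?addr0; last first.
  by move=> a /negPf ab; apply: big1 => c _; rewrite E ab mulr0 mul0r.
rewrite (bigD1 b) //= [X in _ + X]big1 ?addr0; last first.
  by move=> a /negPf ab; rewrite E ab andbF mulr0 mul0r.
by rewrite E !eqxx /= hadamard_conj mulrAC.
Qed.

(** Projecting the ancilla on [b] and loading [sigma] leaves a product of the ancilla, [sigma] and a
    rest, whatever [W] was. Afterwards the two Hadamard gates around the controlled [g] make the
    branches with and without [g] interfere, with sign + if [b = b'] and - otherwise. *)
Lemma hadamard_test b b' W W' :
  (forall x y, entry W' x y = entry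
    (apply_gate (gate1 h q) (load_copy 0 sigma (project q b W))) (G x) (G y)) ->
  \tr (project q b' (apply_gate (gate1 h q) W')) =
  \tr (project q b W) * ((1 + (-1) ^+ (b != b') *
    ((\sum_u entry sigma (g u) u + \sum_u entry sigma u (g u)) / 2)) / 2).
Proof.
move=> W'E; pose ga (a : bool) u := if a then g u else u.
(* Product of the four Hadamard amplitudes when the ancilla is [a] in the row and [d] in the column
   between the two gates. *)
pose c a d := h b' a * (h a b * h d b) * h b' d.
have trE b1 W1 : \tr (project q b1 W1) =
    \sum_(x : bits 'I_K | x q == b1) entry W1 x x.
  rewrite trace_entry [RHS]big_mkcond; apply: eq_bigr => x _.
  by rewrite entry_opmx andbb.
have diagE (x : bits 'I_K) : x q == b' -> entry (apply_gate (gate1 h q) W') x x =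
    (\sum_a \sum_d c a d * entry sigma (ga a (block N 0 x)) (ga d (block N 0 x)))
    * red W (setbit q b x) (setbit q b x).
  move=> /eqP xq; rewrite entry_gate1 xq big_distrl; apply: eq_bigr => a _ /=.
  rewrite big_distrl; apply: eq_bigr => d _ /=.
  rewrite W'E entry_load_had hadamard_conj !G_block !block_setbit.
  rewrite ![G (setbit _ _ _) q]G_out // !ffunE !eqxx /c /ga.
  rewrite (@red_out W _ _ (setbit q b x) (setbit q b x)).
  - by rewrite !mulrA; ring.
  - by move=> r Nr; rewrite !ffunE; case: eqP => // ?;
      rewrite G_out // ffunE; case: eqP.
  - by move=> r Nr; rewrite !ffunE; case: eqP => // ?;
      rewrite G_out // ffunE; case: eqP.
pose S a d := \sum_u entry sigma (ga a u) (ga d u).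
(* The sum over the first [N] qubits yields [S a d]; the sum over the rest yields the weight of
   outcome [b] in [W]. *)
transitivity ((\sum_a \sum_d c a d * S a d) * \tr (project q b W)).
  rewrite !trE (eq_bigr _ diagE) sum_overwrite; last first.
    by move=> z x; rewrite overwrite_q.
  rewrite (@sum_overwrite (fun x : bits 'I_K => x q == b)); last first.
    by move=> z x; rewrite overwrite_q.
  (* The left-hand sum runs over strings with ancilla bit [b'], the right-hand one over strings with
     ancilla bit [b]. *)
  rewrite (reindex_onto (setbit q b') (setbit q b)); last first.
    move=> x /andP[/eqP xq _]; apply/ffunP => r; rewrite !ffunE.
    by case: eqP => // ->.
  rewrite big_distrr /=; apply: eq_big => x.
    rewrite ffunE !eqxx block_setbit /= andbC; congr (_ && _).
    apply/eqP/eqP => [<-|xb]; first by rewrite ffunE eqxx.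
    by apply/ffunP => r; rewrite !ffunE; case: eqP => // ->.
  move=> /andP[_ /eqP xE].
  have -> : \sum_a \sum_d c a d * S a d = \sum_u \sum_a \sum_d c a d *
      entry sigma (ga a u) (ga d u).
    rewrite [RHS]exchange_big /=; apply: eq_bigr => a _.
    rewrite [RHS]exchange_big /=; apply: eq_bigr => d _.
    by rewrite big_distrr.
  rewrite big_distrl; apply: eq_bigr => u _ /=.
  rewrite block_overwrite; congr (_ * _).
  rewrite -[RHS]/(red W x x).
  have E (r : 'I_K) : (N <= r)%N ->
      setbit q b (overwrite 0 u (setbit q b' x)) r = x r.
    move=> Nr; rewrite ffunE; case: eqP => [->|/eqP rq].
      by rewrite -[in RHS]xE ffunE eqxx.
    by rewrite overwrite_out // ffunE (negPf rq).
  by rewrite (red_out _ E E).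
rewrite [LHS]mulrC; congr (_ * _).
have S00 : S false false = 1 by rewrite /S -trace_entry.
have S11 : S true true = 1.
  rewrite -tr_sigma trace_entry /S /= [RHS](reindex g) //.
  by apply: onW_bij.
rewrite -[\sum_u entry sigma (g u) u]/(S true false).
rewrite -[\sum_u entry sigma u (g u)]/(S false true).
(* The amplitude 1 / sqrt 2 is hidden behind [r], of which only the fourth power matters. *)
have [r r4 hE] : exists2 r : R[i], r ^+ 4 = 4^-1 &
    forall a d, h a d = (-1) ^+ (a && d) * r.
  exists ((Num.sqrt 2)^-1)%:C%C; last first.
    by move=> a d; rewrite /h /hadamard rmorphM rmorph_sign.
  rewrite -rmorphXn /= exprVn (exprM _ 2 2) sqr_sqrtr // fmorphV rmorphXn /=.
  by rewrite rmorph_nat -natrX.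
have -> : \sum_a \sum_d c a d * S a d =
    r ^+ 4 * (2 + (-1) ^+ (b != b') * (S true false + S false true)).
  rewrite !big_bool S00 S11 /c !hE.
  by case: (b); case: (b'); rewrite /= ?expr0 ?expr1; ring.
by rewrite r4; field.
Qed.

End HadamardTest.

(** * The program *)

(* Multiplies register 4 by the [e]-th power of register 0, assuming that
   registers 1 and 2 hold 1 and 0. In this code and the next, [o] is the
   address of the first instruction. *)
Definition power_code (o e : nat) : program :=
  [:: Set_ 5 e; Jz 5 (11 + o); Defs.Sub 5 5 1; Set_ 6 0; Add 7 0 2;
      Jz 7 (9 + o); Defs.Sub 7 7 1; Add 6 6 4; Jz 2 (5 + o);
      Add 4 6 2; Jz 2 (1 + o)].

(* Registers: 0, 10, 11, 3 hold n, 2n, 3n, 4n, and 4n is also the address of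
   the ancilla; 4 counts the remaining trials; 8 is the acceptance threshold
   n^(e1 + e2) + n^e1 for register 12, which counts every success twice. *)
Definition trial_code (o : nat) : program :=
  [:: Jz 4 (43 + o); Defs.Sub 4 4 1;
      Defs.Measure 13 3; Copy 2; Copy 0; Copy 10; Copy 11; Had 3; Set_ 5 0;
      (* address 9 + o: loop over the qubits; the addresses of the four copies
         of a qubit go to registers 14, ..., 17, in an order that depends on
         its side of the bipartition *)
      Defs.Sub 6 0 5; Jz 6 (33 + o); Read 6 5; Jz 6 (18 + o);
      Add 14 5 2; Add 15 0 5; Add 16 10 5; Add 17 11 5; Jz 2 (22 + o);
      Add 14 11 5; Add 15 10 5; Add 16 0 5; Add 17 5 2;
      Cnot 15 14; Toffoli 3 14 15; Cnot 15 14;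
      Cnot 16 15; Toffoli 3 15 16; Cnot 16 15;
      Cnot 17 16; Toffoli 3 16 17; Cnot 17 16;
      Add 5 5 1; Jz 2 (9 + o);
      (* address 33 + o *)
      Had 3; Defs.Measure 14 3;
      Defs.Sub 15 13 14; Defs.Sub 16 14 13; Add 15 15 16; Set_ 16 2;
      Jz 15 (41 + o); Jz 2 o; Add 12 12 16; Jz 2 o;
      (* address 43 + o *)
      Defs.Sub 5 8 12; Jz 5 (46 + o); Halt false; Halt true].

(** Register 8 saves n^e1 before register 4 goes on to n^(e1 + e2), the number of trials. Register 2
    keeps its initial value 0: adding it copies a register, and [Jz] on it is an unconditional
    jump. *)
Definition pt_program (e1 e2 : nat) : program :=
  [:: Set_ 1 1; Set_ 4 1] ++ power_code 2 e1 ++ [:: Add 8 4 2] ++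
  power_code 14 e2 ++
  [:: Add 10 0 0; Add 11 10 0; Add 3 11 0; Add 8 8 4] ++ trial_code 29.

Definition except (rs : seq nat) (rg rg' : nat -> nat) : Prop :=
  forall r, r \notin rs -> rg' r = rg r.

Ltac at_pc H i := exact: (H i isT).
Ltac reg := rewrite /update /=; reflexivity.
Ltac step H i := first
 [ eapply outputs_set; [at_pc H i|]
 | eapply outputs_add; [at_pc H i|reg|]
 | eapply outputs_sub; [at_pc H i|reg|]
 | eapply outputs_read; [at_pc H i|reg|] ].
Ltac jump H i := eapply outputs_jump; [at_pc H i|rewrite /update /=|].
Ltac nojump H i := eapply outputs_nojump; [at_pc H i|rewrite /update /=|].

(** * Correctness of the computation of powers *)

Section Power.
Variables (R : realType) (K n : nat) (P : program) (rho : operator R 'I_n).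
Variables (b : bool) (m : nat) (mm : nat -> nat) (W : operator R 'I_K).
Variables (v : R[i]) (o e : nat).
Hypothesis code : forall i, (i < 11)%N -> onth P (i + o) = onth (power_code o e) i.
Implicit Types (rg : nat -> nat).
Notation outputs := (@outputs R K P n rho b).

(** Multiplication by repeated addition; the invariant is the value of register 6 plus register 7
    times register 4. *)
Lemma outputs_product t rg d : rg 7 = d -> rg 1 = 1%N -> rg 2 = 0%N ->
  (forall rg', except [:: 6; 7] rg rg' -> rg' 6 = (rg 6 + d * rg 4)%N ->
    outputs t m (Config (9 + o) rg' mm) W v) ->
  outputs (4 * d + 1 + t)%N m (Config (5 + o) rg mm) W v.
Proof.
elim: d rg => [|d IHd] rg r7 r1 r2 H.
  by jump code 5%N => //; apply: H => // ; rewrite addn0.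
apply: (@outputs_weaken _ _ _ _ _ _ (4 + (4 * d + 1 + t)) m) => //; first lia.
nojump code 5%N; first by rewrite r7.
step code 6%N; step code 7%N; jump code 8%N => //.
apply: IHd; rewrite /update /= ?r7 ?r1 //; first lia.
move=> rg' E E6; apply: H.
  move=> r rr; rewrite E //; move: rr; rewrite !inE /update.
  by case: eqP => // _; case: eqP.
by rewrite E6; lia.
Qed.

(** The invariant is register 4 times [n] to the power held in register 5. A round costs four
    instructions, the inner loop, and two more. *)
Lemma outputs_power_loop t rg e' : rg 5 = e' -> rg 0 = n ->
  rg 1 = 1%N -> rg 2 = 0%N ->
  (forall rg', except [:: 4; 5; 6; 7] rg rg' -> rg' 4 = (rg 4 * n ^ e')%N ->
    outputs t m (Config (11 + o) rg' mm) W v) ->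
  outputs ((4 * n + 8) * e' + 1 + t)%N m (Config (1 + o) rg mm) W v.
Proof.
elim: e' rg => [|e' IHe] rg r5 r0 r1 r2 H.
  by rewrite muln0; jump code 1%N => //; apply: H => //; rewrite muln1.
apply: (@outputs_weaken _ _ _ _ _ _
  (4 + (4 * n + 1 + (2 + ((4 * n + 8) * e' + 1 + t)))) m) => //.
  by rewrite mulnS; lia.
nojump code 1%N; first by rewrite r5.
step code 2%N; step code 3%N; step code 4%N.
apply: outputs_product; rewrite /update /= ?r0 ?r1 ?r2 ?addn0 //.
move=> rg1 E1 E6; step code 9%N; jump code 10%N; first by rewrite E1.
apply: IHe; rewrite /update /= ?(E1 0%N, E1 1%N, E1 2%N, E1 5%N) //=.
  by rewrite r5; lia.
move=> rg' E E4; apply: H.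
  move=> r rr; rewrite E //; move: rr; rewrite !inE /update !negb_or.
  move=> /and4P[r4 rr5 r6 r7]; rewrite (negPf r4) E1.
    by rewrite (negPf r7) (negPf r6) (negPf rr5).
  by rewrite !inE negb_or r6.
rewrite E4 E6 /update /= r2 expnS; ring.
Qed.

Lemma outputs_power t rg : rg 0 = n -> rg 1 = 1%N -> rg 2 = 0%N ->
  (forall rg', except [:: 4; 5; 6; 7] rg rg' -> rg' 4 = (rg 4 * n ^ e)%N ->
    outputs t m (Config (11 + o) rg' mm) W v) ->
  outputs ((4 * n + 8) * e + 2 + t)%N m (Config o rg mm) W v.
Proof.
move=> r0 r1 r2 H.
apply: (@outputs_weaken _ _ _ _ _ _ (1 + ((4 * n + 8) * e + 1 + t)) m) => //.
  by lia.
step code 0%N; apply: outputs_power_loop => // rg' E E4; apply: H => // r rr.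
rewrite E // /update; case: eqP rr => // ->.
by rewrite !inE.
Qed.

End Power.

(** * The cyclic shifts of the four copies *)

Section Cycles.
Variables (n : nat) (chi : nat -> bool).

(** Adding 3 modulo 4 gives the predecessor without truncated subtraction. *)
Definition neighbour (a : bool) (c : nat) : nat :=
  if a then ((c + 3) %% 4)%N else ((c + 1) %% 4)%N.

Lemma neighbourK a c : (c < 4)%N -> neighbour (~~ a) (neighbour a c) = c.
Proof. by case: a; case: c => [|[|[|[|]]]]. Qed.

(* Bit [i] of copy [c] comes from the copy before [c] if [chi i], and from the
   copy after [c] otherwise. *)
Definition copy_cycle (u : bits 'I_(4 * n)) : bits 'I_(4 * n) :=
  [ffun r : 'I_(4 * n) =>
    bitat u (neighbour (chi (r %% n)) (r %/ n) * n + r %% n)].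

(** Models the loop over the qubits after [j] rounds; for [j = n] it is [copy_cycle] controlled by
    the ancilla. *)
Definition partial_cycle K (q : 'I_K) (j : nat) (x : bits 'I_K) : bits 'I_K :=
  [ffun r : 'I_K =>
    if [&& x q, r < 4 * n & r %% n < j]%N
    then bitat x (neighbour (chi (r %% n)) (r %/ n) * n + r %% n) else x r].

Lemma partial_cycle0 K (q : 'I_K) x : partial_cycle q 0 x = x.
Proof. by apply/ffunP => r; rewrite ffunE ltn0 !andbF. Qed.

Lemma block_partial_cycle K (q : 'I_K) x : (4 * n <= q)%N ->
  block (4 * n) 0 (partial_cycle q n x) =
  if x q then copy_cycle (block (4 * n) 0 x) else block (4 * n) 0 x.
Proof.
move=> nq; have qK := ltn_ord q; apply: bitatP => p pn.
have pK : (p < K)%N by lia.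
have n0 : (0 < n)%N by lia.
rewrite bitat_block pn add0n -[p in bitat _ p]/(val (Ordinal pK)) bitatE ffunE /=.
rewrite pn ltn_mod n0 /= andbT; case: ifP => _; last first.
  by rewrite bitat_block pn -bitatE.
rewrite -[p in RHS]/(val (Ordinal pn)) bitatE ffunE /=.
rewrite bitat_block; case: ifP => //.
have := ltn_pmod p n0; rewrite /neighbour; set i := (p %% n)%N => im /negP[].
have : ((if chi i then ((p %/ n + 3) %% 4) else ((p %/ n + 1) %% 4)) < 4)%N.
  by case: (chi i); rewrite ltn_mod.
by case: (if chi i then _ else _) => [|[|[|[|//]]]] _; lia.
Qed.

Lemma partial_cycle_out K (q : 'I_K) x (r : 'I_K) : (4 * n <= r)%N ->
  partial_cycle q n x r = x r.
Proof. by move=> nr; rewrite ffunE ltnNge nr andbF. Qed.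

(** The inverse runs both cycles backwards, that is, it uses the complement of [chi]. *)
Lemma copy_cycle_bij : bijective copy_cycle.
Proof.
exists (fun u => [ffun r : 'I_(4 * n) =>
    bitat u (neighbour (~~ chi (r %% n)) (r %/ n) * n + r %% n)]) => u;
  apply/ffunP => r; rewrite ffunE.
all: have r4 := ltn_ord r; have n0 : (0 < n)%N by lia.
all: have := ltn_pmod r n0; have := divn_eq r n.
all: have : (r %/ n < 4)%N by rewrite ltn_divLR.
all: set i := (r %% n)%N; set c := (r %/ n)%N => c4 rE im.
all: have nb4 a : (neighbour a c < 4)%N by case: a; rewrite ltn_mod.
- have pn : (neighbour (~~ chi i) c * n + i < 4 * n)%N.
    by case: (neighbour _ _) (nb4 (~~ chi i)) => [|[|[|[|//]]]] _; lia.
  rewrite -[(_ + i)%N]/(val (Ordinal pn)) bitatE ffunE /= modnMDl divnMDl //.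
  rewrite modn_small // divn_small // addn0 -[X in neighbour X]negbK neighbourK //.
  by rewrite -rE bitatE.
- have pn : (neighbour (chi i) c * n + i < 4 * n)%N.
    by case: (neighbour _ _) (nb4 (chi i)) => [|[|[|[|//]]]] _; lia.
  rewrite -[(_ + i)%N]/(val (Ordinal pn)) bitatE ffunE /= modnMDl divnMDl //.
  rewrite modn_small // divn_small // addn0 neighbourK //.
  by rewrite -rE bitatE.
Qed.

Lemma bitat_fredkin K (q p r : 'I_K) (x : bits 'I_K) s :
  bitat (fredkin q p r x) s =
  if x q then if s == p then bitat x r else if s == r then bitat x p
    else bitat x s
  else bitat x s.
Proof.
case: (ltnP s K) => sK; last first.
  rewrite !(bitat_out _ sK) !gtn_eqF ?if_same //;
    by apply: leq_trans sK; apply: ltn_ord.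
rewrite -[s]/(val (Ordinal sK)) !bitatE ffunE.
by rewrite -!(inj_eq val_inj).
Qed.

(** Transpositions along the chain [a0], [a1], [a2], [a3] compose to a 4-cycle of the copies of
    qubit [j]; listing the copies backwards reverses its direction. These addresses are disjoint
    from those of the qubits below [j], which [partial_cycle q j] moves. *)
Lemma partial_cycleS K (q a0 a1 a2 a3 : 'I_K) j x :
  (4 * n <= q)%N -> (j < n)%N ->
  (if chi j then [/\ a0 = (0 * n + j)%N :> nat, a1 = (1 * n + j)%N :> nat,
       a2 = (2 * n + j)%N :> nat & a3 = (3 * n + j)%N :> nat]
   else [/\ a0 = (3 * n + j)%N :> nat, a1 = (2 * n + j)%N :> nat,
       a2 = (1 * n + j)%N :> nat & a3 = (0 * n + j)%N :> nat]) ->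
  partial_cycle q j
    (fredkin q a0 a1 (fredkin q a1 a2 (fredkin q a2 a3 x))) =
  partial_cycle q j.+1 x.
Proof.
move=> nq jn aE; set y := fredkin _ _ _ _.
have qa (z : bits 'I_K) a a' : q != a -> q != a' -> fredkin q a a' z q = z q.
  by move=> /negPf qa /negPf qa'; rewrite ffunE qa qa' if_same.
have [[q0 q1] [q2 q3]] :
    ((q != a0) * (q != a1) * ((q != a2) * (q != a3)))%type.
  rewrite -!(inj_eq val_inj) /=.
  by case: (chi j) aE => -[-> -> -> ->]; do !split; lia.
have yq : y q = x q by rewrite /y !qa.
have n0 : (0 < n)%N by lia.
have dE k l : (k * n + j == l * n + j)%N = (k == l).
  by rewrite eqn_add2r eqn_pmul2r.
have yE s : bitat y s = if x q then
    if s == a0 then bitat x a3 else if s == a1 then bitat x a0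
    else if s == a2 then bitat x a1 else if s == a3 then bitat x a2
    else bitat x s else bitat x s.
  rewrite /y !bitat_fredkin !qa //; case: (x q) => //.
  by case: (chi j) aE => -[-> -> -> ->]; rewrite !dE /=;
    do 4! case: eqP => _ //=.
clearbody y; apply/ffunP => r; rewrite !ffunE yq.
case: (boolP (x q)) => /= xq; last first.
  by rewrite -!bitatE yE (negPf xq).
rewrite -[x r]bitatE -[y r]bitatE !yE xq.
case: (ltnP r (4 * n)) => /= r4; last first.
  by case: (chi j) aE => -[-> -> -> ->]; rewrite !gtn_eqF //; lia.
have := ltn_pmod r n0; have := divn_eq r n.
have : (r %/ n < 4)%N by rewrite ltn_divLR.
move: (r %% n)%N (r %/ n)%N => i c c4 -> im.
have nb4 a : (neighbour a c < 4)%N by case: a; rewrite ltn_mod.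
case: (ltngtP i j) => [ij|ij|ij].
- rewrite ltnS (ltnW ij).
  have ne k l : (k * n + i == l * n + j)%N = false.
    apply/eqP => /(congr1 (modn^~ n)); rewrite !modnMDl !modn_small //; lia.
  by case: (chi j) aE => -[-> -> -> ->]; rewrite !ne.
- rewrite ltnS leqNgt ij /=.
  have ne k l : (k * n + i == l * n + j)%N = false.
    apply/eqP => /(congr1 (modn^~ n)); rewrite !modnMDl !modn_small //; lia.
  by case: (chi j) aE => -[-> -> -> ->]; rewrite !ne.
- rewrite {}ij ltnS leqnn /= /neighbour.
  case: (chi j) aE => -[-> -> -> ->]; rewrite !dE;
    by case: c c4 {nb4} => [|[|[|[|//]]]] _.
Qed.

End Cycles.

(** Expectation of [F] after [j] independent trials that each add 2 to [a] with probability [p].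
    Over a general ring it covers both the complex weights of the machine and the real estimates. *)
Fixpoint walk (C : pzRingType) (p : C) (F : nat -> C) (j a : nat) : C :=
  if j is j'.+1 then p * walk p F j' (a + 2)%N + (1 - p) * walk p F j' a
  else F a.

Definition decision (C : pzSemiRingType) (theta : nat) (b : bool) (a : nat) : C :=
  ((theta <= a)%N == b)%:R.

(** * Correctness of the trials *)

Section Trials.
Variables (R : realType) (n : nat) (P : program) (rho : operator R 'I_n).
Variables (b : bool) (K : nat) (q : 'I_K) (chi : nat -> bool) (o : nat).
Variable (mm : nat -> nat).
Hypothesis code : forall i, (i < 47)%N -> onth P (i + o) = onth (trial_code o) i.
Hypothesis qE : q = (4 * n)%N :> nat.
Hypothesis mmE : forall i, (i < n)%N -> mm i = chi i.
Hypothesis tr_rho : \tr (copies rho 4) = 1.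
Implicit Types (rg : nat -> nat) (W : operator R 'I_K).
Notation outputs := (@outputs R K P n rho b).

Lemma outputs_cswaps t m rg W v (a0 a1 a2 a3 : 'I_K) :
  rg 3 = q -> rg 14 = a0 -> rg 15 = a1 -> rg 16 = a2 -> rg 17 = a3 ->
  q != a0 -> q != a1 -> q != a2 -> q != a3 ->
  a0 != a1 -> a1 != a2 -> a2 != a3 ->
  outputs t m (Config (31 + o) rg mm)
    (cswap q a2 a3 (cswap q a1 a2 (cswap q a0 a1 W))) v ->
  outputs (9 + t)%N m (Config (22 + o) rg mm) W v.
Proof.
move=> r3 r14 r15 r16 r17 q0 q1 q2 q3 a01 a12 a23 H.
eapply outputs_cnot; [at_pc code 22%N|exact: r15|exact: r14|by rewrite eq_sym|].
eapply outputs_toffoli; [at_pc code 23%N|exact: r3|exact: r14|exact: r15| |].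
  by rewrite /= !inE negb_or q0 q1 a01.
eapply outputs_cnot; [at_pc code 24%N|exact: r15|exact: r14|by rewrite eq_sym|].
eapply outputs_cnot; [at_pc code 25%N|exact: r16|exact: r15|by rewrite eq_sym|].
eapply outputs_toffoli; [at_pc code 26%N|exact: r3|exact: r15|exact: r16| |].
  by rewrite /= !inE negb_or q1 q2 a12.
eapply outputs_cnot; [at_pc code 27%N|exact: r16|exact: r15|by rewrite eq_sym|].
eapply outputs_cnot; [at_pc code 28%N|exact: r17|exact: r16|by rewrite eq_sym|].
eapply outputs_toffoli; [at_pc code 29%N|exact: r3|exact: r16|exact: r17| |].
  by rewrite /= !inE negb_or q2 q3 a23.
eapply outputs_cnot; [at_pc code 30%N|exact: r17|exact: r16|by rewrite eq_sym|].
exact: H.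
Qed.

(** The loop invariant is that the current state is [W0] relabelled by [partial_cycle] for the
    qubits treated so far. *)
Lemma outputs_cycle t m W0 v d j rg W : (j + d = n)%N -> rg 5 = j ->
  rg 0 = n -> rg 2 = 0%N -> rg 1 = 1%N -> rg 3 = q ->
  rg 10 = (2 * n)%N -> rg 11 = (3 * n)%N ->
  (forall x y, entry W x y =
    entry W0 (partial_cycle n chi q j x) (partial_cycle n chi q j y)) ->
  (forall rg' W', except [:: 5; 6; 14; 15; 16; 17] rg rg' ->
    (forall x y, entry W' x y =
      entry W0 (partial_cycle n chi q n x) (partial_cycle n chi q n y)) ->
    outputs t m (Config (33 + o) rg' mm) W' v) ->
  outputs (20 * d + 2 + t)%N m (Config (9 + o) rg mm) W v.
Proof.
elim: d j rg W => [|d IHd] j rg W jn r5 r0 r2 r1 r3 r10 r11 WE H.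
  rewrite addn0 in jn; rewrite jn in r5 WE.
  step code 9%N; jump code 10%N; first by rewrite r0 r5 subnn.
  apply: H => // r; rewrite !inE negb_or => /andP[_ /norP[/negPf r6 _]].
  by rewrite /update r6.
apply: (@outputs_weaken _ _ _ _ _ _
  (9 + (9 + (2 + (20 * d + 2 + t)))) m) => //; first by lia.
have jn' : (j < n)%N by lia.
have jK (c : nat) : (c < 4)%N -> (c * n + j < K)%N.
  move=> c4; have := ltn_ord q; rewrite qE.
  by case: c c4 => [|[|[|[|//]]]] _; lia.
step code 9%N; nojump code 10%N; first by rewrite r0 r5; lia.
step code 11%N.
pose a0 := Ordinal (jK 0%N isT); pose a1 := Ordinal (jK 1%N isT).
pose a2 := Ordinal (jK 2%N isT); pose a3 := Ordinal (jK 3%N isT).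
have qa c (c4 : (c < 4)%N) : q != Ordinal (jK c c4).
  rewrite -(inj_eq val_inj) /= qE gtn_eqF //.
  by case: c c4 => [|[|[|[|//]]]] _; lia.
have aa c c' (c4 : (c < 4)%N) (c4' : (c' < 4)%N) :
    c != c' -> Ordinal (jK c c4) != Ordinal (jK c' c4').
  by rewrite -(inj_eq val_inj) /= eqn_add2r eqn_pmul2r //; lia.
have nq : (4 * n <= q)%N by rewrite qE.
case chij : (chi j).
  nojump code 12%N; first by rewrite r5 mmE // chij.
  step code 13%N; step code 14%N; step code 15%N; step code 16%N.
  jump code 17%N => //.
  apply: (@outputs_cswaps _ _ _ _ _ a0 a1 a2 a3); rewrite /update //=;
    try (rewrite ?(r0, r5, r2, r10, r11, r3); lia); try exact: qa; try exact: aa.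
  step code 31%N; jump code 32%N => //.
  apply: (IHd j.+1) => //; rewrite /update /= ?r5 ?r1 ?addn1 //; first lia.
    move=> x y; rewrite !entry_cswap ?WE; try exact: qa; try exact: aa.
    by rewrite !partial_cycleS // chij.
  move=> rg' W' E E'; apply: H => // r rr; rewrite E //; move: rr.
  rewrite !inE !negb_or => /and5P[/negPf r5' /negPf r6 /negPf r14 /negPf r15].
  by move=> /andP[/negPf r16 /negPf r17]; rewrite r5' r6 r14 r15 r16 r17.
jump code 12%N; first by rewrite r5 mmE // chij.
(* This branch falls through to the gates instead of jumping over the other one, hence is one step
   shorter. *)
apply: (@outputs_weaken _ _ _ _ _ _
  (4 + (9 + (2 + (20 * d + 2 + t)))) m) => //.
step code 18%N; step code 19%N; step code 20%N; step code 21%N.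
apply: (@outputs_cswaps _ _ _ _ _ a3 a2 a1 a0); rewrite /update //=;
  try (rewrite ?(r0, r5, r2, r10, r11, r3); lia); try exact: qa; try exact: aa.
step code 31%N; jump code 32%N => //.
apply: (IHd j.+1) => //; rewrite /update /= ?r5 ?r1 ?addn1 //; first lia.
  move=> x y; rewrite !entry_cswap ?WE; try exact: qa; try exact: aa.
  by rewrite !partial_cycleS // chij.
move=> rg' W' E E'; apply: H => // r rr; rewrite E //; move: rr.
rewrite !inE !negb_or => /and5P[/negPf r5' /negPf r6 /negPf r14 /negPf r15].
by move=> /andP[/negPf r16 /negPf r17]; rewrite r5' r6 r14 r15 r16 r17.
Qed.

Let sigma := copies rho 4.
Let p := (1 + (\sum_u entry sigma (copy_cycle chi u) u +
  \sum_u entry sigma u (copy_cycle chi u)) / 2) / 2.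

(** A success is the agreement of two measurements, so the ancilla need not be reset: a trial
    multiplies the weight by [p] or [1 - p] whatever state the earlier trials left behind, which
    makes the trials independent. *)
Lemma outputs_trials j a theta rg W : rg 4 = j -> rg 12 = a ->
  rg 8 = theta -> rg 0 = n -> rg 2 = 0%N -> rg 1 = 1%N -> rg 3 = q ->
  rg 10 = (2 * n)%N -> rg 11 = (3 * n)%N ->
  outputs ((20 * n + 25) * j + 4)%N (4 * j) (Config o rg mm) W
    (\tr W * walk p (decision _ theta b) j a).
Proof.
elim: j a rg W => [|j IHj] a rg W r4 r12 r8 r0 r2 r1 r3 r10 r11.
  rewrite /= muln0; jump code 0%N => //; step code 43%N.
  rewrite /decision; case: (leqP theta a) => ta.
    jump code 44%N; first by rewrite r8 r12; lia.
    have -> : \tr W * (true == b)%:R = if true == b then \tr W else 0.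
      by case: b => /=; rewrite ?mulr1 ?mulr0.
    by eapply (@outputs_weaken _ _ _ _ _ _ 1 0);
      last (eapply outputs_halt; at_pc code 46%N).
  nojump code 44%N; first by rewrite r8 r12; lia.
  have -> : \tr W * (false == b)%:R = if false == b then \tr W else 0.
    by case: b => /=; rewrite ?mulr1 ?mulr0.
  by eapply (@outputs_weaken _ _ _ _ _ _ 1 0);
      last (eapply outputs_halt; at_pc code 45%N).
rewrite -(trace_project q W) mulrDl.
have qK := ltn_ord q; rewrite qE in qK.
apply: (@outputs_weaken _ _ _ _ _ _ (3 + (6 + (20 * n + 2 + (2 + (8 +
  ((20 * n + 25) * j + 4)))))) (4 + 4 * j)); first by rewrite mulnS; lia.
  by rewrite mulnS.
nojump code 0%N; first by rewrite r4.
step code 1%N.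
have branch (c : bool) rg1 : except [:: 4; 13] rg rg1 -> rg1 4 = j ->
    rg1 13 = c ->
    outputs (6 + (20 * n + 2 + (2 + (8 + ((20 * n + 25) * j + 4)))))
      (4 + 4 * j) (Config (3 + o) rg1 mm) (project q c W)
      (\tr (project q c W) * walk p (decision _ theta b) j.+1 a).
  move=> E1 E4 E13.
  eapply (@outputs_copy _ _ _ _ _ _ _ _ _ _ _ _ _ _ (0 * n));
    [at_pc code 3%N|by rewrite E1|by lia|].
  eapply (@outputs_copy _ _ _ _ _ _ _ _ _ _ _ _ _ _ (1 * n));
    [at_pc code 4%N|by rewrite E1 // r0 mul1n|by lia|].
  eapply (@outputs_copy _ _ _ _ _ _ _ _ _ _ _ _ _ _ (2 * n));
    [at_pc code 5%N|by rewrite E1|by lia|].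
  eapply (@outputs_copy _ _ _ _ _ _ _ _ _ _ _ _ _ _ (3 * n));
    [at_pc code 6%N|by rewrite E1|by lia|].
  (* Inserting the load of zero copies starts the chain that merges the four loads into one. *)
  rewrite -[X in load_copy (0 * n) rho X](load_copies0 rho) !load_copiesS.
  eapply (@outputs_had _ _ _ _ _ _ _ _ _ _ _ _ _ _ q);
    [at_pc code 7%N|by rewrite E1|].
  step code 8%N.
  apply: (@outputs_cycle _ _ (apply_gate (gate1 (@hadamard R) q)
    (load_copy 0 (copies rho 4) (project q c W))) _ n 0);
    rewrite /update //= ?E1 //.
    by move=> x y; rewrite !partial_cycle0.
  move=> rg2 W2 E2 W2E.
  have F (r : nat) : r \notin [:: 4; 5; 6; 13; 14; 15; 16; 17] -> rg2 r = rg r.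
    rewrite !inE !negb_or => /and5P[r4' r5 r6 r13] /and4P[r14 r15 r16 r17].
    rewrite E2 /update ?inE ?negb_or ?r5 ?r6 ?r14 ?r15 ?r16 //.
    by rewrite (negPf r5) E1 // !inE negb_or r4' r13.
  eapply (@outputs_had _ _ _ _ _ _ _ _ _ _ _ _ _ _ q);
    [at_pc code 33%N|by rewrite F|].
  have nq : (4 * n <= q)%N by rewrite qE.
  have test c' : \tr (project q c' (apply_gate (gate1 (@hadamard R) q) W2)) =
      \tr (project q c W) * (if c == c' then p else 1 - p).
    rewrite (hadamard_test nq (fun x => block_partial_cycle chi x nq)
      (@partial_cycle_out n chi K q) (copy_cycle_bij n chi) tr_rho c' W2E) /p.
    by congr (_ * _); case: eqP => _; rewrite /= ?expr0 ?expr1; field.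
  (* The recursion of [walk] is the sum over the second outcome, where equality with the first
     outcome [c] counts as success. *)
  have -> : \tr (project q c W) * walk p (decision _ theta b) j.+1 a =
    \tr (project q false (apply_gate (gate1 (@hadamard R) q) W2)) *
      walk p (decision _ theta b) j (if c == false then (a + 2)%N else a) +
    \tr (project q true (apply_gate (gate1 (@hadamard R) q) W2)) *
      walk p (decision _ theta b) j (if c == true then (a + 2)%N else a).
    by rewrite !test; case: (c) => /=; ring.
  have next (c' : bool) rg3 : except [:: 14] rg2 rg3 -> rg3 14 = c' ->
      outputs (8 + ((20 * n + 25) * j + 4)) (4 * j) (Config (35 + o) rg3 mm)
        (project q c' (apply_gate (gate1 (@hadamard R) q) W2))
        (\tr (project q c' (apply_gate (gate1 (@hadamard R) q) W2)) *
         walk p (decision _ theta b) j (if c == c' then (a + 2)%N else a)).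
    move=> E3 r14; have r13 : rg3 13 = c by rewrite E3 // E2 // /update /= E13.
    have G (r : nat) : r \notin [:: 4; 5; 6; 13; 14; 15; 16; 17] -> rg3 r = rg r.
      move=> rr; rewrite E3 ?F //; move: rr; rewrite !inE !negb_or.
      by move=> /and5P[_ _ _ _ /andP[]].
    have G4 : rg3 4 = j by rewrite E3 // E2 // /update /= E4.
    step code 35%N; step code 36%N; step code 37%N; step code 38%N.
    case: (eqVneq c c') => [cc'|/negPf cc'].
      jump code 39%N; first by rewrite r13 r14 cc' subnn.
      step code 41%N; jump code 42%N; first by rewrite G.
      apply: outputs_weaken (IHj _ _ _ _ _ _ _ _ _ _ _ _);
        rewrite /update /= ?G4 ?G ?r12 //.
    nojump code 39%N; first by rewrite r13 r14; case: (c) (c') cc' => -[].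
    jump code 40%N; first by rewrite G.
    apply: outputs_weaken (IHj _ _ _ _ _ _ _ _ _ _ _ _);
        rewrite /update /= ?G4 ?G ?r12 //.
    by lia.
  eapply (@outputs_measure _ _ _ _ _ _ _ _ _ _ _ _ _ _ _ _ q);
    [at_pc code 34%N|by rewrite F| |]; apply: next => // r;
    by rewrite inE /update => /negPf ->.
eapply (@outputs_measure _ _ _ _ _ _ _ _ _ _ _ _ _ _ _ _ q);
  [at_pc code 2%N|by []| |]; apply: branch => //.
- by move=> r; rewrite !inE negb_or /update => /andP[/negPf -> /negPf ->].
- by rewrite /update /= r4 r1 subn1.
- by move=> r; rewrite !inE negb_or /update => /andP[/negPf -> /negPf ->].
- by rewrite /update /= r4 r1 subn1.
Qed.

End Trials.

Definition side n (A : {set 'I_n}) (i : nat) : bool :=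
  if insub i is Some j then j \in A else false.

(* Probability that the two ancilla measurements of a trial agree. *)
Definition agreement (R : realType) n (A : {set 'I_n}) (rho : operator R 'I_n) :
  R[i] :=
  (1 + (\sum_u entry (copies rho 4) (copy_cycle (side A) u) u +
        \sum_u entry (copies rho 4) u (copy_cycle (side A) u)) / 2) / 2.

Lemma trace_ground (R : realType) K : \tr (ground R K) = 1.
Proof.
rewrite trace_entry (bigD1 [ffun=> false]) //= big1 => [|x /negPf x0].
  by rewrite entry_opmx eqxx addr0.
by rewrite entry_opmx x0.
Qed.

Lemma outputs_pt_program (R : realType) K e1 e2 n (A : {set 'I_n})
    (rho : operator R 'I_n) (b : bool) : (4 * n < K)%N ->
  \tr (copies rho 4) = 1 ->
  outputs (pt_program e1 e2) rho b
    ((4 * n + 8) * (e1 + e2) + 15 + (20 * n + 25) * n ^ (e1 + e2))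
    (4 * n ^ (e1 + e2)) (input A) (ground R K)
    (walk (agreement A rho) (decision _ (n ^ (e1 + e2) + n ^ e1)%N b)
       (n ^ (e1 + e2)) 0).
Proof.
move=> nK tr1; rewrite -[walk _ _ _ _]mul1r -(trace_ground R K).
set T := (n ^ (e1 + e2))%N.
have code i : (i < 80)%N ->
    onth (pt_program e1 e2) i = onth (pt_program e1 e2) i by [].
apply: (@outputs_weaken _ _ _ _ _ _ (2 + ((4 * n + 8) * e1 + 2 + (1 +
  ((4 * n + 8) * e2 + 2 + (4 + ((20 * n + 25) * T + 4)))))) (4 * T)) => //.
  by lia.
step code 0%N; step code 1%N.
apply: (@outputs_power _ _ _ _ _ _ _ _ _ _ 2 e1); rewrite /update //=.
  by do 11! case=> //.
move=> rg1 E1 E14; step code 13%N.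
apply: (@outputs_power _ _ _ _ _ _ _ _ _ _ 14 e2);
  rewrite /update /= ?(E1 0%N, E1 1%N, E1 2%N) //.
  by do 11! case=> //.
move=> rg2 E2 E24.
step code 25%N; step code 26%N; step code 27%N; step code 28%N.
have r4 : rg2 4 = T by rewrite E24 /update /= E14 /update /= mul1n -expnD.
have r0 : rg2 0 = n by rewrite E2 // /update /= E1.
apply: (@outputs_trials _ _ _ _ _ _ (Ordinal nK) (side A) 29);
  rewrite /update /= ?r0 ?r4 //; try (by rewrite E2 //= E1); try lia.
- by do 47! case=> //.
- by move=> i ni; rewrite /side; case: insub.
- by rewrite E2 // /update /= E14 mul1n addn0 addnC.
Qed.

(** Chosen so that a single bound of degree [(e1 + e2).+1] covers the steps (n^(e1 + e2) trials of
    linear length), the copies and the [4 * n + 1] qubits. *)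
Definition pt_constant (e1 e2 : nat) : nat := (8 * (e1 + e2) + 50)%N.

Lemma output_prob_pt_program (R : realType) e1 e2 n (A : {set 'I_n})
    (rho : operator R 'I_n) (b : bool) : \tr (copies rho 4) = 1 ->
  output_prob (pt_program e1 e2)
    (poly_bound (pt_constant e1 e2) (e1 + e2).+1 n) A rho b =
  complex.Re (walk (agreement A rho)
    (decision _ (n ^ (e1 + e2) + n ^ e1)%N b) (n ^ (e1 + e2)) 0).
Proof.
move=> tr1; congr complex.Re.
have n1 : (n <= n ^ (e1 + e2).+1)%N.
  by case: n {A rho tr1} => // n; rewrite expnS leq_pmulr // expn_gt0.
(* The summand 1 is for [n = 0] and exponent 0, where 0^0 = 1. *)
have n2 : (n ^ (e1 + e2) <= n ^ (e1 + e2).+1 + 1)%N.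
  case: n {A rho tr1 n1} => [|n].
    by case: (e1 + e2)%N => [|e] //; rewrite !exp0n.
  by rewrite expnS mulSn; lia.
apply: (@outputs_pt_program R _ e1 e2 n A rho b _ tr1).
- by rewrite /poly_bound /pt_constant; nia.
- have := leq_mul n1 (leqnn (e1 + e2)); have := expnS n (e1 + e2).
  rewrite /poly_bound /pt_constant.
  move: n1 n2; move: (n ^ _.+1)%N => N; move: (n ^ _)%N => M; nia.
- by rewrite /poly_bound /pt_constant; nia.
Qed.

(** * Concentration *)

Section Walk.
Variables (R : realFieldType) (p : R).
Hypothesis p01 : 0 <= p <= 1.
Implicit Types (F G : nat -> R).

Lemma le_walk F G j a : (forall x, F x <= G x) -> walk p F j a <= walk p G j a.
Proof.
move=> FG; have /andP[p0 p1] := p01.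
elim: j a => //= j IHj a; rewrite lerD // ler_wpM2l // subr_ge0.
by [].
Qed.

(** Squared bias plus variance: a trial adds 0 or 2, so its variance is [4 * (p * (1 - p))]. *)
Lemma walk_sqr v j a :
  walk p (fun x => (x%:R - v) ^+ 2) j a =
  (a%:R + 2 * j%:R * p - v) ^+ 2 + 4 * j%:R * (p * (1 - p)).
Proof.
elim: j a => [|j IHj] a /=; first by ring.
by rewrite !IHj natrD -[j.+1]addn1 natrD; ring.
Qed.

Lemma walkZ c F j a : walk p (fun x => c * F x) j a = c * walk p F j a.
Proof. by elim: j a => //= j IHj a; rewrite !IHj; ring. Qed.

End Walk.

Lemma walkD (R : pzRingType) (p : R) (F G : nat -> R) j a :
  walk p F j a + walk p G j a = walk p (fun x => F x + G x) j a.
Proof.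
by elim: j a => //= j IHj a; rewrite -!IHj !mulrDr addrACA.
Qed.

Lemma walk_cst (R : pzRingType) (p c : R) j a : walk p (fun=> c) j a = c.
Proof. by elim: j a => //= j IHj a; rewrite !IHj -mulrDl addrC subrK mul1r. Qed.

Lemma eq_walk (R : pzRingType) (p : R) (F G : nat -> R) j a :
  F =1 G -> walk p F j a = walk p G j a.
Proof. by move=> FG; elim: j a => //= j IHj a; rewrite !IHj. Qed.

Lemma walk_rmorph (R S : pzRingType) (f : {rmorphism R -> S}) p F j a :
  walk (f p) (f \o F) j a = f (walk p F j a).
Proof.
by elim: j a => //= j IHj a; rewrite !IHj rmorphD !rmorphM rmorphB rmorph1.
Qed.

Lemma walk_decision (R : pzRingType) (p : R) theta j a :
  walk p (decision R theta true) j a + walk p (decision R theta false) j a = 1.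
Proof.
rewrite walkD -[RHS](walk_cst p 1 j a); apply: eq_walk => x.
by rewrite /decision; case: (theta <= x)%N; rewrite ?addr0 ?add0r.
Qed.

(* Chebyshev's inequality, for the sum of [j] variables in {0, 2} of mean 2p. *)
Lemma walk_chebyshev (R : realFieldType) (p delta : R) theta j (b : bool) :
  0 <= p <= 1 -> 0 < delta ->
  (if b then theta%:R + delta <= 2 * j%:R * p
   else 2 * j%:R * p + delta <= theta%:R) ->
  1 - j%:R / delta ^+ 2 <= walk p (decision R theta b) j 0.
Proof.
move=> p01 d0 far; set F := fun x : nat => (x%:R - 2 * j%:R * p) ^+ 2.
have [p0 p1] := andP p01.
(* It suffices to bound the probability of the wrong output from above. *)
have -> : walk p (decision R theta b) j 0 =
    1 - walk p (decision R theta (~~ b)) j 0.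
  apply/eqP; rewrite -(walk_decision p theta j 0).
  by case: (b) => /=; rewrite ?addrK // [_ + walk _ _ _ _]addrC addrK.
rewrite lerD2l lerN2.
(* Markov's inequality: a wrong output means a deviation of at least [delta] from the mean, where
   [F] is at least [delta ^+ 2]. *)
apply: (@le_trans _ _ (walk p (fun x => delta ^- 2 * F x) j 0)).
  apply: le_walk => // x; rewrite /decision mulrC ler_pdivlMr ?exprn_gt0 //.
  have F0 : 0 <= F x by apply: sqr_ge0.
  case: b far => far; case: (leqP theta x) => xt /=; rewrite ?mul0r ?mul1r //.
    have : x%:R <= theta%:R :> R by rewrite ler_nat ltnW.
    by rewrite /F; nra.
  have : theta%:R <= x%:R :> R by rewrite ler_nat.
  by rewrite /F; nra.
rewrite walkZ walk_sqr add0r subrr expr0n add0r mulrC ler_wpM2r //.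
  by rewrite invr_ge0 exprn_ge0 // ltW.
have j0 : 0 <= j%:R :> R by rewrite ler0n.
(* This square makes [4 * (p * (1 - p))] at most 1, so the variance of the sum is at most [j]. *)
have : 0 <= (1 - 2 * p) ^+ 2 by apply: sqr_ge0.
have : 0 <= p * (1 - p) by rewrite mulr_ge0 // subr_ge0.
by move=> *; nra.
Qed.

(** * The fourth moment of the partial transpose *)

Section Moment.
Variables (R : realType) (n : nat) (A : {set 'I_n}) (rho : operator R 'I_n).
Implicit Types (x y z : bits 'I_n).

Lemma block_overwrite_last m (v : bits 'I_n) (x : bits 'I_(m.+1 * n)) :
  block n (m * n) (overwrite (m * n) v x) = v.
Proof.
apply: bitatP => p pn; rewrite bitat_block pn bitat_overwrite.
by have E := mulSn m n; case: ifP => [_|]; [congr bitat|]; lia.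
Qed.

Lemma block_overwrite_lt m c (v : bits 'I_n) (u : bits 'I_(m * n))
    (w : bits 'I_(m.+1 * n)) : (c < m)%N ->
  block n (c * n) (overwrite (m * n) v (overwrite 0 u w)) =
  block n (c * n) u.
Proof.
move=> cm; apply: bitatP => p pn; rewrite !bitat_block pn !bitat_overwrite.
have : (c.+1 * n <= m * n)%N by rewrite leq_mul2r cm orbT.
have := mulSn m n; rewrite (mulSn c) => E cmn.
case: ifP => [?|_]; first by exfalso; lia.
by case: ifP => [_|]; [congr bitat|]; lia.
Qed.

Lemma sum_copies4 (F : bits 'I_n -> bits 'I_n -> bits 'I_n -> bits 'I_n -> R[i]) :
  \sum_(u : bits 'I_(4 * n)) F (block n (0 * n) u) (block n (1 * n) u)
    (block n (2 * n) u) (block n (3 * n) u) =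
  \sum_w \sum_z \sum_y \sum_x F x y z w.
Proof.
rewrite sum_bits_split; apply: eq_bigr => w _.
rewrite sum_bits_split; apply: eq_bigr => z _.
rewrite sum_bits_split; apply: eq_bigr => y _.
rewrite sum_bits_split; apply: eq_bigr => x _.
by rewrite (sum_bits0 _ [ffun=> false]) !(block_overwrite_last, block_overwrite_lt).
Qed.

Lemma block_copy_cycle c (u : bits 'I_(4 * n)) : (c < 4)%N ->
  block n (c * n) (copy_cycle (side A) u) =
  splice A (block n ((c + 3) %% 4 * n) u) (block n ((c + 1) %% 4 * n) u).
Proof.
move=> c4; apply/ffunP => i; rewrite -bitatE bitat_block ltn_ord.
have iK : (c * n + i < 4 * n)%N.
  by have := ltn_ord i; case: c c4 => [|[|[|[|//]]]] _; lia.
have n0 : (0 < n)%N by apply: leq_trans (ltn_ord i).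
rewrite -[(c * n + i)%N]/(val (Ordinal iK)) bitatE !ffunE /=.
rewrite modnMDl divnMDl // modn_small // divn_small // addn0.
have -> : side A i = (i \in A) by rewrite /side valK.
by rewrite /neighbour; case: (i \in A).
Qed.

Lemma trace_copies : \tr rho = 1 -> \tr (copies rho 4) = 1.
Proof.
rewrite !trace_entry => tr1.
under eq_bigr do rewrite entry_opmx !big_ord_recr big_ord0 /= mul1r.
rewrite (sum_copies4 (fun x y z w => entry rho x x * entry rho y y *
  entry rho z z * entry rho w w)).
under eq_bigr do under eq_bigr do under eq_bigr do
  rewrite -!big_distrl /= tr1 mul1r.
under eq_bigr do under eq_bigr do rewrite -!big_distrl /= tr1 mul1r.
by under eq_bigr do rewrite -!big_distrl /= tr1 mul1r.
Qed.

Lemma trace_power4 (X : operator R 'I_n) :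
  \tr (X *m X *m (X *m X)) = \sum_x \sum_y \sum_z \sum_w
    entry X x z * entry X z y * (entry X y w * entry X w x).
Proof.
rewrite trace_entry; apply: eq_bigr => x _; rewrite entry_mul.
by apply: eq_bigr => y _; rewrite !entry_mul big_distrlr /=.
Qed.

Lemma splice_splice x y z w : splice A (splice A x y) (splice A z w) = splice A x w.
Proof. by apply/ffunP => i; rewrite !ffunE; case: (i \in A). Qed.

Lemma splicexx x : splice A x x = x.
Proof. by apply/ffunP => i; rewrite ffunE if_same. Qed.

(** The partial transpose exchanges row and column on the complement of [A], which turns the
    opposite cycle there into the one on [A]; both then close up to a single trace of a fourfold
    product. *)
Lemma sum_copy_cycle :
  \sum_u entry (copies rho 4) (copy_cycle (side A) u) u =
  \tr (partial_transpose A rho *m partial_transpose A rho *m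
       (partial_transpose A rho *m partial_transpose A rho)).
Proof.
under eq_bigr do rewrite entry_opmx !big_ord_recr big_ord0 /= mul1r
  !block_copy_cycle //=.
rewrite (sum_copies4 (fun x y z w => entry rho (splice A w y) x *
  entry rho (splice A x z) y * entry rho (splice A y w) z *
  entry rho (splice A z x) w)) trace_power4.
rewrite !pair_big /=.
(* [f] expresses the strings of the four copies by the four summation indices of the trace,
   recombining their two halves; [g] is its inverse. *)
pose f (v : bits 'I_n * bits 'I_n * bits 'I_n * bits 'I_n) :=
  let: (x, y, z, w) := v in
  (splice A x w, splice A w y, splice A y z, splice A z x).
pose g (u : bits 'I_n * bits 'I_n * bits 'I_n * bits 'I_n) :=
  let: (w, z, y, x) := u in
  (splice A w x, splice A y z, splice A x y, splice A z w).
rewrite (reindex_onto f g) /=; last first.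
  by case=> [[[x y] z] w] _ /=; rewrite !splice_splice !splicexx.
apply: eq_big => [[[[x y] z] w]|[[[x y] z] w] _] /=.
  by rewrite !splice_splice !splicexx eqxx.
by rewrite !splice_splice !entry_opmx; ring.
Qed.

End Moment.

(** * Spectral theory of positive semidefinite matrices *)

Section PositiveSemidefinite.
Local Open Scope sesquilinear_scope.
Variable R : realType.
Local Notation C := R[i].

Definition psd N (M : 'M[C]_N) : Prop :=
  forall v : 'rV[C]_N, 0 <= (v *m M *m v ^t*) 0 0.

(** Polarization: the form takes real values on sums of basis vectors with coefficients 1 and 'i,
    which determines [M j i] as the conjugate of [M i j]. *)
Lemma psd_adj N (M : 'M[C]_N) : psd M -> M ^t* = M.
Proof.
move=> M0; pose form (u v : 'rV[C]_N) := (u *m M *m v ^t*) 0 0.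
have formE i j : form (delta_mx 0 i) (delta_mx 0 j) = M i j.
  rewrite /form -rowE; have -> : (delta_mx 0 j : 'rV[C]_N) ^t* = delta_mx j 0.
    by apply/matrixP => a b; rewrite !mxE andbC conjC_nat.
  by rewrite -colE !mxE.
have conj1 (x y : C) : (x + y)^* = x + y -> ('i * (x - y))^* = 'i * (x - y) ->
    y^* = x.
  rewrite rmorphM rmorphB !rmorphD /= conjCi mulNr => E1 E2.
  have {}E2 : x^* - y^* = - (x - y).
    by apply: (mulfI (neq0Ci C)); rewrite mulrN -E2 opprK.
  have E3 : y^* *+ 2 = x *+ 2.
    rewrite !mulr2n -[RHS](_ : (x + y) + (x - y) = _); last by ring.
    by rewrite -E1 -[x - y]opprK -E2; ring.
  by move/eqP: E3; rewrite eqrMn2r /= => /eqP.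
have conj_form u : (form u u)^* = form u u.
  by apply/CrealP/ger0_real/M0.
have form_lin c u v : form (u + c *: v) (u + c *: v) =
    form u u + c * c^* * form v v + (c * form v u + c^* * form u v).
  rewrite /form !mulmxDl linearD /= map_mxD !mulmxDr.
  rewrite linearZ /= map_mxZ -!scalemxAl -!scalemxAr !mxE.
  by rewrite -!/(form _ _); ring.
have key (c : C) u v : (c * form v u + c^* * form u v)^* =
    c * form v u + c^* * form u v.
  have -> : c * form v u + c^* * form u v =
      form (u + c *: v) (u + c *: v) - form u u - c * c^* * form v v.
    by rewrite form_lin; ring.
  rewrite rmorphB rmorphB /= !conj_form rmorphM /= conj_form.
  by rewrite rmorphM /= conjCK [_^* * _]mulrC.
apply/matrixP => i j; rewrite !mxE -!formE; apply: conj1.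
  have := key 1 (delta_mx 0 j) (delta_mx 0 i).
  by rewrite conjC1 !mul1r.
have := key 'i (delta_mx 0 j) (delta_mx 0 i).
by rewrite conjCi mulNr -mulrBr.
Qed.

Lemma psd_normal N (M : 'M[C]_N) : psd M -> M \is normalmx.
Proof. by move=> /psd_adj M0; apply/normalmxP; rewrite M0. Qed.

Definition eigenvalues N (M : 'M[C]_N) (i : 'I_N) : R :=
  complex.Re (spectral_diag M 0 i).

Lemma psd_spectral N (M : 'M[C]_N) : psd M ->
  M = (spectralmx M) ^t* *m diag_mx (spectral_diag M) *m spectralmx M.
Proof.
move=> M0; rewrite -invmx_unitary ?spectral_unitarymx //.
exact/orthomx_spectralP/psd_normal.
Qed.

Lemma row_spectral N (M : 'M[C]_N) i : psd M ->
  row i (spectralmx M) *m M = spectral_diag M 0 i *: row i (spectralmx M).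
Proof.
move=> M0; rewrite {2}(psd_spectral M0) !mulmxA -row_mul.
have /unitarymxP -> := spectral_unitarymx M.
rewrite -row_mul mul1mx; apply/rowP => j; rewrite !mxE.
rewrite (bigD1 i) //= big1 => [|k /negPf ki]; rewrite !mxE.
  by rewrite eqxx addr0.
by rewrite eq_sym ki mul0r.
Qed.

Lemma row_unitary_norm N (P : 'M[C]_N) i : P \is unitarymx ->
  (row i P *m (row i P) ^t*) 0 0 = 1.
Proof.
move=> /unitarymxP PP; transitivity ((P *m P ^t*) i i).
  by rewrite !mxE; apply: eq_bigr => j _; rewrite !mxE.
by rewrite PP mxE eqxx.
Qed.

Lemma spectral_diagE N (M : 'M[C]_N) i : psd M ->
  spectral_diag M 0 i = (eigenvalues M i)%:C%C.
Proof.
move=> M0; have := M0 (row i (spectralmx M)).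
rewrite row_spectral // -scalemxAl mxE.
rewrite row_unitary_norm ?spectral_unitarymx //.
by rewrite mulr1 /eigenvalues => /ger0_real /RRe_real.
Qed.

Lemma eigenvalues_ge0 N (M : 'M[C]_N) i : psd M -> 0 <= eigenvalues M i.
Proof.
move=> M0; have := M0 (row i (spectralmx M)).
rewrite row_spectral // -scalemxAl mxE.
rewrite row_unitary_norm ?spectral_unitarymx //.
by rewrite mulr1 spectral_diagE // lecR.
Qed.

Lemma trace_unitary_conj N (P M : 'M[C]_N) : P \is unitarymx ->
  \tr (P ^t* *m M *m P) = \tr M.
Proof. by move=> /unitarymxP PP; rewrite mxtrace_mulC mulmxA PP mul1mx. Qed.

Lemma mul_unitary_conj N (P M M' : 'M[C]_N) : P \is unitarymx ->
  (P ^t* *m M *m P) *m (P ^t* *m M' *m P) = P ^t* *m (M *m M') *m P.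
Proof.
move=> /unitarymxP PP.
by rewrite !mulmxA -[_ *m P *m P ^t*]mulmxA PP mulmx1.
Qed.

Lemma trace_psd N (M : 'M[C]_N) : psd M ->
  \tr M = (\sum_i eigenvalues M i)%:C%C.
Proof.
move=> M0; rewrite {1}(psd_spectral M0) trace_unitary_conj ?spectral_unitarymx //.
rewrite mxtrace_diag rmorph_sum; apply: eq_bigr => i _.
exact: spectral_diagE.
Qed.

Lemma trace_psd_sqr N (M : 'M[C]_N) : psd M ->
  \tr (M *m M) = (\sum_i eigenvalues M i ^+ 2)%:C%C.
Proof.
move=> M0; rewrite {1 2}(psd_spectral M0) mul_unitary_conj ?spectral_unitarymx //.
rewrite trace_unitary_conj ?spectral_unitarymx // mulmx_diag mxtrace_diag.
rewrite rmorph_sum; apply: eq_bigr => i _; rewrite mxE spectral_diagE //.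
by rewrite -rmorphM.
Qed.

Lemma sqrtC_real (x : R) : 0 <= x -> sqrtC (x%:C%C) = (Num.sqrt x)%:C%C :> C.
Proof.
by move=> x0; rewrite -{1}(sqr_sqrtr x0) rmorphXn sqrCK // lecR sqrtr_ge0.
Qed.

Lemma sqrtmxE N (M : 'M[C]_N) : psd M ->
  sqrtmx M = (spectralmx M) ^t* *m
    diag_mx (\row_i (Num.sqrt (eigenvalues M i))%:C%C) *m spectralmx M.
Proof.
move=> M0; rewrite /sqrtmx invmx_unitary ?spectral_unitarymx //.
congr (_ *m diag_mx _ *m _); apply/rowP => i; rewrite !mxE.
by rewrite spectral_diagE // sqrtC_real // eigenvalues_ge0.
Qed.

Lemma trace_sqrtmx N (M : 'M[C]_N) : psd M ->
  complex.Re (\tr (sqrtmx M)) = \sum_i Num.sqrt (eigenvalues M i).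
Proof.
move=> M0; rewrite sqrtmxE // trace_unitary_conj ?spectral_unitarymx //.
rewrite mxtrace_diag (eq_bigr (fun i => (Num.sqrt (eigenvalues M i))%:C%C)).
  by rewrite -rmorph_sum.
by move=> i _; rewrite mxE.
Qed.

Lemma adjM m n p (M : 'M[C]_(m, n)) (M' : 'M[C]_(n, p)) :
  (M *m M') ^t* = M' ^t* *m M ^t*.
Proof. by rewrite trmx_mul map_mxM. Qed.

Lemma sqrtmx_adj N (M : 'M[C]_N) : psd M -> (sqrtmx M) ^t* = sqrtmx M.
Proof.
move=> M0; rewrite sqrtmxE // !adjM trmxCK -mulmxA; congr (_ *m (_ *m _)).
rewrite tr_diag_mx map_diag_mx; congr diag_mx; apply/rowP => i.
by rewrite !mxE; apply: conjc_real.
Qed.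

Lemma sqrtmx_sqr N (M : 'M[C]_N) : psd M -> sqrtmx M *m sqrtmx M = M.
Proof.
move=> M0; rewrite {1 2}sqrtmxE // mul_unitary_conj ?spectral_unitarymx //.
rewrite [RHS](psd_spectral M0) mulmx_diag; congr (_ *m diag_mx _ *m _).
apply/rowP => i; rewrite !mxE spectral_diagE // -rmorphM -expr2.
by rewrite sqr_sqrtr // eigenvalues_ge0.
Qed.

Lemma psd_conj m N (S : 'M[C]_(m, N)) (M : 'M[C]_N) :
  psd M -> psd (S *m M *m S ^t*).
Proof. by move=> M0 v; have := M0 (v *m S); rewrite adjM !mulmxA. Qed.

Lemma psd1 N : psd (1%:M : 'M[C]_N).
Proof.
move=> v; rewrite mulmx1 mxE sumr_ge0 // => i _.
by rewrite !mxE -normCK exprn_ge0.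
Qed.

Lemma psd_gram m N (S : 'M[C]_(m, N)) : psd (S *m S ^t*).
Proof. by rewrite -[S in S *m _]mulmx1; apply/psd_conj/psd1. Qed.

Lemma psd_trace_ge0 N (M : 'M[C]_N) : psd M -> 0 <= \tr M.
Proof.
by move=> M0; rewrite trace_psd // lecR sumr_ge0 // => i _; apply: eigenvalues_ge0.
Qed.

Lemma sum_sqr_le (I : finType) (a : I -> R) : (forall i, 0 <= a i) ->
  \sum_i a i ^+ 2 <= (\sum_i a i) ^+ 2.
Proof.
move=> a0; rewrite expr2 big_distrl ler_sum // => i _ /=.
rewrite expr2 ler_wpM2l // (bigD1 i) //= lerDl.
exact: sumr_ge0.
Qed.

(** With the eigenvalues of [M] in the proof below, the trace is their sum and the fidelity is the
    square of the sum of their roots. *)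
Lemma fidelity_ge_trace N (rho sigma : 'M[C]_N) : psd rho -> psd sigma ->
  complex.Re (\tr (rho *m sigma)) <= fidelity rho sigma.
Proof.
move=> rho0 sigma0; set M := sqrtmx rho *m sigma *m sqrtmx rho.
have M0 : psd M by rewrite /M -{2}(sqrtmx_adj rho0); apply: psd_conj.
have -> : \tr (rho *m sigma) = \tr M.
  by rewrite /M [RHS]mxtrace_mulC mulmxA sqrtmx_sqr.
rewrite /fidelity -/M trace_sqrtmx // trace_psd //=.
apply: le_trans (sum_sqr_le _) => [|i]; last exact: sqrtr_ge0.
by apply: ler_sum => i _; rewrite sqr_sqrtr // eigenvalues_ge0.
Qed.

Lemma density_trace_sqr N (rho : 'M[C]_N) : density rho ->
  0 < complex.Re (\tr (rho *m rho)) <= 1.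
Proof.
move=> [rho0 tr1]; rewrite trace_psd_sqr //=.
have e0 i : 0 <= eigenvalues rho i by apply: eigenvalues_ge0.
have e1 : \sum_i eigenvalues rho i = 1.
  by apply: complexI; rewrite -trace_psd.
apply/andP; split; last first.
  by apply: le_trans (sum_sqr_le e0) _; rewrite e1 expr1n.
rewrite lt_neqAle sumr_ge0 ?andbT => [|i _]; last exact: sqr_ge0.
rewrite eq_sym psumr_neq0 => [|i _]; last exact: sqr_ge0.
have : \sum_i eigenvalues rho i != 0 by rewrite e1 oner_eq0.
rewrite psumr_neq0 => [/hasP[i ii /= ei]|i _]; last exact: e0.
by apply/hasP; exists i; rewrite //= exprn_gt0.
Qed.

End PositiveSemidefinite.

(** * A product state overlapping with the given state *)

Section ProductStates.
Local Open Scope sesquilinear_scope.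
Variables (R : realType) (n : nat) (A : {set 'I_n}).
Local Notation C := R[i].
Implicit Types (x y s t : bits 'I_n) (v w : 'rV[C]_#|bits 'I_n|).

Definition glue (a : bits (subsystem A)) (b : bits (subsystem (~: A))) :
  bits 'I_n :=
  [ffun i => if (insub i : option {i | i \in A}) is Some k then a k
             else if (insub i : option {i | i \in ~: A}) is Some k then b k
             else false].

Lemma restrict_glue a b : Defs.restrict A (glue a b) = a.
Proof. by apply/ffunP => k; rewrite !ffunE valK. Qed.

Lemma restrictC_glue a b : Defs.restrict (~: A) (glue a b) = b.
Proof.
apply/ffunP => k; rewrite !ffunE insubN ?valK //.
by have := valP k; rewrite inE.
Qed.

Lemma glue_restrict x y :
  glue (Defs.restrict A x) (Defs.restrict (~: A) y) = splice A x y.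
Proof.
apply/ffunP => i; rewrite !ffunE; case: insubP => [k -> ki|iA].
  by rewrite ffunE ki.
rewrite (negPf iA); case: insubP => [k _ ki|]; first by rewrite ffunE ki.
by rewrite inE iA.
Qed.

Lemma glue_spliceA a b t : splice A (glue a b) t = glue a (Defs.restrict (~: A) t).
Proof. by rewrite -glue_restrict restrict_glue. Qed.

Lemma glue_spliceC a b t : splice A t (glue a b) = glue (Defs.restrict A t) b.
Proof. by rewrite -glue_restrict restrictC_glue. Qed.

Lemma sum_glue (F : bits 'I_n -> C) : \sum_x F x = \sum_a \sum_b F (glue a b).
Proof.
rewrite pair_big /=.
rewrite (reindex_onto (fun p => glue p.1 p.2)
  (fun x => (Defs.restrict A x, Defs.restrict (~: A) x))) /=.
  by apply: eq_bigl => -[a b] /=; rewrite restrict_glue restrictC_glue eqxx.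
by move=> x _; rewrite glue_restrict splicexx.
Qed.

Definition gram (T I : finType) (f : bits T -> I -> C) : operator R T :=
  opmx (fun a a' => \sum_i f a i * (f a' i)^*).

Lemma psd_gram_op (T I : finType) (f : bits T -> I -> C) : psd (gram f).
Proof.
pose S : 'M[C]_(#|bits T|, #|I|) := \matrix_(k, l) f (enum_val k) (enum_val l).
suff -> : gram f = S *m S ^t* by apply: psd_gram.
apply: entryP => a a'; rewrite entry_opmx /entry mxE.
rewrite (reindex (@enum_val I (mem I))) /=; last exact/onW_bij/enum_val_bij.
by apply: eq_bigr => l _; rewrite !mxE !enum_rankK.
Qed.

Lemma trace_gram (T I : finType) (f : bits T -> I -> C) :
  \tr (gram f) = \sum_a \sum_i f a i * (f a i)^*.
Proof. by rewrite trace_entry; apply: eq_bigr => a _; rewrite entry_opmx. Qed.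

(** With c = tr (rho Z), the difference of the two sides is the trace of [rho] conjugated by
    [Z ^t* - c^*], a variance and hence nonnegative. *)
Lemma trace_cauchy_schwarz N (rho Z : 'M[C]_N) : psd rho -> \tr rho = 1 ->
  \tr (rho *m Z) * (\tr (rho *m Z))^* <= \tr (rho *m (Z *m Z ^t*)).
Proof.
move=> rho0 tr1; set c := \tr (rho *m Z).
have cJ : \tr (Z ^t* *m rho) = c^*.
  rewrite /c -{1}(psd_adj rho0) -adjM.
  by rewrite /mxtrace rmorph_sum; apply: eq_bigr => i _; rewrite !mxE.
have := psd_trace_ge0 (psd_conj (Z ^t* - (c^*)%:M) rho0).
have -> : (Z ^t* - (c^*)%:M) ^t* = Z - c%:M.
  rewrite linearB /= map_mxB trmxCK tr_scalar_mx map_scalar_mx /=.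
  by rewrite conjCK.
rewrite mulmxBl mulmxBr !mulmxBl !linearB /= !mul_scalar_mx !mul_mx_scalar.
rewrite -!scalemxAl !linearZ /= cJ -/c tr1 -mulmxA mxtrace_mulC -mulmxA => H.
rewrite -subr_ge0; apply: le_trans H _; rewrite le_eqVlt; apply/orP; left.
by apply/eqP; rewrite /GRing.scale /=; ring.
Qed.

Variable rho : operator R 'I_n.
Hypothesis rho_density : density rho.
Let X := partial_transpose A rho.

Lemma partial_transpose_adj : X ^t* = X.
Proof.
have [/psd_adj rhoJ _] := rho_density.
apply: entryP => x y; rewrite entry_adj !entry_opmx -[in RHS]rhoJ.
by rewrite entry_adj.
Qed.

Let coef v x := v 0 (enum_rank x).

(** The partial trace over [A] of the rank one operator with entries v_x conj(v_y). Its counterpart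
    [reducedA] carries an additional complex conjugation, which comes from the conjugated [w] in
    [twist]. *)
Definition reducedB v : operator R (subsystem (~: A)) :=
  gram (fun b a => coef v (glue a b)).
Definition reducedA w : operator R (subsystem A) :=
  gram (fun a b => (coef w (glue a b))^*).

(** The partial transpose of the rank one matrix [w ^t* *m v]. Under the trace, the partial
    transpose can be moved from [rho] to this matrix. *)
Definition twist v w : operator R 'I_n :=
  opmx (fun t s => coef v (splice A s t) * (coef w (splice A t s))^*).

Lemma trace_twist v w : \tr (rho *m twist v w) = (v *m X *m w ^t*) 0 0.
Proof.
rewrite trace_entry; under eq_bigr do rewrite entry_mul.
rewrite mxE sum_bits exchange_big /= pair_big /=.
have -> : \sum_y (v *m X) 0 (enum_rank y) * (w ^t*) (enum_rank y) 0 =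
    \sum_y \sum_x coef v x * entry X x y * (coef w y)^*.
  apply: eq_bigr => y _; rewrite !mxE sum_bits big_distrl.
  by apply: eq_bigr => x _.
rewrite pair_big /=.
rewrite (reindex_onto
  (fun p : bits 'I_n * bits 'I_n => (splice A p.1 p.2, splice A p.2 p.1))
  (fun p => (splice A p.1 p.2, splice A p.2 p.1))) /=; last first.
  by move=> [x y] _ /=; rewrite !splice_splice !splicexx.
apply: eq_big => [[y x]|[y x] _] /=.
  by rewrite !splice_splice !splicexx eqxx.
by rewrite !entry_opmx !splice_splice !splicexx; ring.
Qed.

(** In [twist], [v] sees only the [A] part of the column index [s] and [w] only its other part, so
    the sum over [s] factorizes. *)
Lemma twist_gram v w : twist v w *m (twist v w) ^t* =
  tensor (reducedA w) (reducedB v).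
Proof.
apply: entryP => t t'; rewrite entry_mul !entry_opmx sum_glue.
rewrite mulrC big_distrlr /=; apply: eq_bigr => a _; apply: eq_bigr => b _.
rewrite entry_adj !entry_opmx !glue_spliceA !glue_spliceC.
by rewrite !rmorphM /= !conjCK; ring.
Qed.

Lemma norm_coef v : (v *m v ^t*) 0 0 = \sum_x coef v x * (coef v x)^*.
Proof. by rewrite mxE sum_bits; apply: eq_bigr => x _; rewrite !mxE. Qed.

Lemma trace_reducedB v : \tr (reducedB v) = (v *m v ^t*) 0 0.
Proof. by rewrite norm_coef sum_glue exchange_big trace_gram. Qed.

Lemma trace_reducedA w : \tr (reducedA w) = (w *m w ^t*) 0 0.
Proof.
rewrite norm_coef sum_glue trace_gram.
by apply: eq_bigr => a _; apply: eq_bigr => b _; rewrite conjCK mulrC.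
Qed.

(* With [v] a unit eigenvector, [w = v X] and [Z = twist v w], the
   Cauchy-Schwarz inequality bounds [e ^ 2 = tr (rho Z) ^ 2] by the overlap of
   [rho] with [Z Z^t*], which is [e] times a product state. *)
Lemma separable_overlap i : let e := eigenvalues (X ^t* *m X) i in 0 < e ->
  exists sigma, [/\ separable A sigma, psd sigma &
    e <= complex.Re (\tr (rho *m sigma))].
Proof.
move=> e e0; have [rho0 tr1] := rho_density.
have H0 : psd (X ^t* *m X) by rewrite -{2}(trmxCK X); apply: psd_gram.
(* [v] is an eigenvector of the square of [X], but perhaps not of [X] itself; hence a second vector
   [w] instead of a multiple of [v]. *)
pose v := row i (spectralmx (X ^t* *m X)); pose w := v *m X.
have vv : (v *m v ^t*) 0 0 = 1 by rewrite row_unitary_norm ?spectral_unitarymx.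
have ww : (w *m w ^t*) 0 0 = e%:C%C.
  rewrite /w adjM partial_transpose_adj -mulmxA [X *m _]mulmxA.
  rewrite -{1}partial_transpose_adj mulmxA row_spectral // spectral_diagE //.
  by rewrite -scalemxAl mxE vv mulr1.
have eC : e%:C%C != 0 :> C.
  by rewrite -(rmorph0 (real_complex R)) (inj_eq (@complexI R)) gt_eqF.
pose sigma := tensor ((e%:C%C)^-1 *: reducedA w) (reducedB v).
have sigmaE : sigma = (e%:C%C)^-1 *: (twist v w *m (twist v w) ^t*).
  rewrite twist_gram; apply: entryP => t t'.
  have entryZ T (M : operator R T) c (x y : bits T) :
      entry (c *: M) x y = c * entry M x y.
    by rewrite /entry mxE.
  by rewrite [LHS]entry_opmx !entryZ [entry (tensor _ _) _ _]entry_opmx mulrA.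
have psdZ N (M : 'M[C]_N) : psd M -> psd ((e%:C%C)^-1 *: M).
  move=> M0 u; rewrite -scalemxAr -scalemxAl mxE mulr_ge0 // invr_ge0 lecR ltW //.
exists sigma; split.
- exists 1%N, (fun=> 1), (fun=> (e%:C%C)^-1 *: reducedA w), (fun=> reducedB v).
  split=> //; first by rewrite big_ord1.
  + split; first exact/psdZ/psd_gram_op.
    by rewrite mxtraceZ trace_reducedA ww mulVf.
  + by split; [exact: psd_gram_op|rewrite trace_reducedB].
  + by rewrite big_ord1 scale1r.
- by rewrite sigmaE; apply/psdZ/psd_gram.
have := trace_cauchy_schwarz (twist v w) rho0 tr1.
rewrite trace_twist -/w ww sigmaE -scalemxAr mxtraceZ.
have -> : (e%:C%C)^* = e%:C%C :> C by apply: conjc_real.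
rewrite -ler_pdivlMl ?ltcR //.
by rewrite lecE => /andP[_].
Qed.

End ProductStates.

(** Lagrange's identity: twice the difference of the two sides is a double sum of squares. *)
Lemma sum_cauchy_schwarz (R : realFieldType) (I : finType) (f g : I -> R) :
  (\sum_i f i * g i) ^+ 2 <= (\sum_i f i ^+ 2) * (\sum_i g i ^+ 2).
Proof.
have : 0 <= \sum_i \sum_j (f i * g j - f j * g i) ^+ 2.
  by apply: sumr_ge0 => i _; apply: sumr_ge0 => j _; apply: sqr_ge0.
have -> : \sum_i \sum_j (f i * g j - f j * g i) ^+ 2 =
    (\sum_i \sum_j f i ^+ 2 * g j ^+ 2 + \sum_i \sum_j g i ^+ 2 * f j ^+ 2) -
    2 * \sum_i \sum_j (f i * g i) * (f j * g j).
  rewrite mulr_sumr -sumrN -!big_split; apply: eq_bigr => i _ /=.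
  rewrite mulr_sumr -sumrN -!big_split; apply: eq_bigr => j _ /=.
  by ring.
rewrite -!big_distrlr /=; set a := \sum_i f i ^+ 2; set b := \sum_i g i ^+ 2.
by set c := \sum_i _; nra.
Qed.

(** For the power sums, Cauchy-Schwarz gives s3^2 <= s2 s4 and s2^2 <= s1 s3, hence s2^4 <= s1^2 s2
    s4; then s2 is cancelled. *)
Lemma sum_hoelder (R : rcfType) (I : finType) (a : I -> R) :
  (forall i, 0 <= a i) ->
  (\sum_i a i ^+ 2) ^+ 3 <= (\sum_i a i) ^+ 2 * \sum_i a i ^+ 4.
Proof.
move=> a0; set s1 := \sum_i a i; set s2 := \sum_i _; set s4 := \sum_i _ ^+ 4.
pose s3 := \sum_i a i ^+ 3.
have s20 : 0 <= s2 by apply: sumr_ge0 => i _; apply: sqr_ge0.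
have s30 : 0 <= s3 by apply: sumr_ge0 => i _; rewrite exprn_ge0.
have s10 : 0 <= s1 by apply: sumr_ge0.
have h24 : s3 ^+ 2 <= s2 * s4.
  have := sum_cauchy_schwarz a (fun i => a i ^+ 2).
  rewrite (eq_bigr (fun i => a i ^+ 3)) => [|i _]; last by rewrite -exprS.
  rewrite [in X in _ * X](eq_bigr (fun i => a i ^+ 4)) // => i _.
  by rewrite -exprM.
have h13 : s2 ^+ 2 <= s1 * s3.
  have := sum_cauchy_schwarz (fun i => Num.sqrt (a i))
    (fun i => Num.sqrt (a i) * a i).
  rewrite (eq_bigr (fun i => a i ^+ 2)) => [|i _]; last first.
    by rewrite mulrA -expr2 sqr_sqrtr // expr2.
  rewrite [X in _ <= X * _](eq_bigr a) => [|i _]; last by rewrite sqr_sqrtr.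
  rewrite [X in _ <= _ * X](eq_bigr (fun i => a i ^+ 3)) // => i _.
  by rewrite exprMn sqr_sqrtr // -exprS.
have s40 : 0 <= s4 by apply: sumr_ge0 => i _; rewrite exprn_ge0.
have [->|s2n0] := eqVneq s2 0; first by rewrite expr0n mulr_ge0 ?sqr_ge0.
have s2p : 0 < s2 by rewrite lt_neqAle eq_sym s2n0.
rewrite -(ler_pM2r s2p) -exprSr.
apply: (@le_trans _ _ ((s1 * s3) ^+ 2)).
  by rewrite (exprM s2 2 2) ler_sqr ?nnegrE ?sqr_ge0 // mulr_ge0.
by rewrite exprMn -[X in _ <= X]mulrA ler_wpM2l ?sqr_ge0 // mulrC.
Qed.

(** * Bounds on the fourth moment *)

Section EntanglementTest.
Local Open Scope sesquilinear_scope.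
Variables (R : realType) (n : nat) (A : {set 'I_n}) (rho : operator R 'I_n).
Hypothesis rho_density : density rho.
Let X := partial_transpose A rho.
Let H := X ^t* *m X.
Let e := eigenvalues H.

Definition moment4 : R := complex.Re (\tr (X *m X *m (X *m X))).

Let HE : H = X *m X. Proof. by rewrite /H partial_transpose_adj. Qed.
Let H_psd : psd H. Proof. by rewrite /H -{2}(trmxCK X); apply: psd_gram. Qed.
Let e_ge0 i : 0 <= e i. Proof. exact: eigenvalues_ge0. Qed.

Lemma trace_moment4 : \tr (X *m X *m (X *m X)) = moment4%:C%C.
Proof. by rewrite /moment4 -HE trace_psd_sqr. Qed.

Lemma moment4E : moment4 = \sum_i e i ^+ 2.
Proof. by rewrite /moment4 -HE trace_psd_sqr. Qed.

(** The partial transpose permutes the entries of a matrix, hence preserves the Hilbert-Schmidt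
    norm. *)
Lemma purityE : complex.Re (\tr (rho *m rho)) = \sum_i e i.
Proof.
suff -> : \tr (rho *m rho) = \tr H by rewrite trace_psd.
rewrite HE !trace_entry.
under eq_bigr do rewrite entry_mul; under [RHS]eq_bigr do rewrite entry_mul.
rewrite !pair_big /= (reindex_onto
  (fun p : bits 'I_n * bits 'I_n => (splice A p.1 p.2, splice A p.2 p.1))
  (fun p => (splice A p.1 p.2, splice A p.2 p.1))) /=; last first.
  by move=> [x y] _ /=; rewrite !splice_splice !splicexx.
apply: eq_big => [[x y]|[x y] _] /=.
  by rewrite !splice_splice !splicexx eqxx.
by rewrite !entry_opmx.
Qed.

Lemma moment4_ge0 : 0 <= moment4.
Proof. by rewrite moment4E sumr_ge0 // => i _; apply: sqr_ge0. Qed.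

Lemma moment4_le1 : moment4 <= 1.
Proof.
rewrite moment4E; apply: le_trans (sum_sqr_le e_ge0) _.
have /andP[p0 p1] := density_trace_sqr rho_density.
by rewrite -purityE exprn_ile1 // ltW.
Qed.

(** Hoelder's inequality for the roots of [e], which are the absolute values of the eigenvalues of
    [X]. *)
Lemma moment4_negativity :
  complex.Re (\tr (rho *m rho)) ^+ 3 <= trace_norm X ^+ 2 * moment4.
Proof.
have := sum_hoelder (fun i => sqrtr_ge0 (e i)).
rewrite purityE moment4E /trace_norm trace_sqrtmx // -/H.
rewrite (eq_bigr e) => [|i _]; last by rewrite sqr_sqrtr.
rewrite [X in _ * X](eq_bigr (fun i => e i ^+ 2)) // => i _.
by rewrite (exprM _ 2 2) sqr_sqrtr.
Qed.

(** The sum of the squares of [e] is at most its maximum times its sum, the purity, which is at most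
    1; the maximal eigenvalue yields the product state. *)
Lemma moment4_separable : 0 < moment4 ->
  exists2 sigma, separable A sigma & moment4 <= fidelity rho sigma.
Proof.
move=> m0; have [rho0 tr1] := rho_density.
have [i0 _] : exists i, 0 < e i.
  apply/existsP; apply: contraTT m0 => /existsPn e0.
  rewrite -leNgt moment4E big1 // => i _.
  by apply/eqP; rewrite sqrf_eq0 eq_le e_ge0 leNgt e0.
pose i := [arg max_(j > i0) e j]%O.
have ei j : e j <= e i by rewrite /i; case: arg_maxP => // k _ /(_ j isT).
have me : moment4 <= e i.
  rewrite moment4E; apply: (@le_trans _ _ (\sum_j e i * e j)).
    by apply: ler_sum => j _; rewrite expr2 ler_wpM2r.
  have /andP[_ p1] := density_trace_sqr rho_density.
  by rewrite -mulr_sumr -purityE ler_piMr.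
have [sigma [sep sigma0 esigma]] :=
  separable_overlap rho_density (lt_le_trans m0 me).
exists sigma => //; apply: le_trans me _; apply: le_trans esigma _.
exact: fidelity_ge_trace.
Qed.

(** The two sums in [agreement] are conjugate because [rho] is Hermitian, and the first is the real
    number [moment4]. *)
Lemma agreementE : agreement A rho = ((1 + moment4) / 2)%:C%C.
Proof.
have [/psd_adj rhoJ _] := rho_density.
have -> : agreement A rho = (1 + (moment4%:C%C + moment4%:C%C) / 2) / 2.
  rewrite /agreement sum_copy_cycle trace_moment4; congr ((1 + (_ + _) / _) / _).
  rewrite -[RHS]conjc_real -trace_moment4 -sum_copy_cycle.
  rewrite -[conjc _]/(_^*) rmorph_sum; apply: eq_bigr => u _.
  rewrite !entry_opmx rmorph_prod; apply: eq_bigr => c _.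
  by rewrite -{1}rhoJ entry_adj.
rewrite [RHS]rmorphM rmorphD rmorph1 fmorphV rmorph_nat.
by field.
Qed.

End EntanglementTest.

(** * Distinguishing the two cases *)

Lemma output_prob_walk (R : realType) e1 e2 n (A : {set 'I_n})
    (rho : operator R 'I_n) (b : bool) : density rho ->
  output_prob (pt_program e1 e2)
    (poly_bound (pt_constant e1 e2) (e1 + e2).+1 n) A rho b =
  walk ((1 + moment4 A rho) / 2)
    (decision R (n ^ (e1 + e2) + n ^ e1)%N b) (n ^ (e1 + e2)) 0.
Proof.
move=> rhoD; have [_ tr1] := rhoD.
rewrite output_prob_pt_program ?trace_copies // agreementE //.
rewrite -[RHS]/(complex.Re (real_complex R _)) -walk_rmorph.
congr complex.Re; apply: eq_walk => x.
by rewrite /decision /= rmorph_nat.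
Qed.

(** Chebyshev's error for n^(e1 + e2) trials and deviation n^e1 / 2 is 4 n^(e2 - e1) = 4 n^-2
    n^-k. *)
Lemma trial_error (R : realFieldType) (N : R) e1 e2 k : 2 <= N ->
  e1 = (e2 + k.+2)%N ->
  N ^+ (e1 + e2) / (N ^+ e1 / 2) ^+ 2 <= N ^- k.
Proof.
move=> N2 ->; have N0 : 0 < N by lra.
have -> : N ^+ (e2 + k.+2 + e2) / (N ^+ (e2 + k.+2) / 2) ^+ 2 = 4 * N ^- 2 * N ^- k.
  rewrite !exprD !exprS; field.
  by rewrite ?expf_neq0 ?gt_eqF.
rewrite ler_piMl ?invr_ge0 ?exprn_ge0 ?(ltW N0) //.
by rewrite ler_pdivrMr ?exprn_gt0 // mul1r; nra.
Qed.

(* cS, cE, cD are the constants of the three O(log n) and f is the growth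
   function in omega(log n), all fixed for the promise; "with high probability"
   is: with failure probability at most n^-k, for any prescribed k.
   Output true means case (a), output false means case (b). *)
Theorem theorem1 (R : realType) (cS cE cD : R) (f : nat -> R) (k : nat)
  (f_omega : f n / ln (n%:R : R) @[n --> \oo] --> +oo) :
  exists (P : program) (c d : nat),
    runs_within R P (poly_bound c d) /\
    \forall n \near \oo,
      forall (A : {set 'I_n}) (rho : operator R 'I_n),
        density rho -> renyi2 rho <= cS * ln n%:R ->
        ((negativity A rho <= cE * ln n%:R /\
          (fidelity_of_separability A rho <= (cD * ln n%:R)%:E)%E) ->
         1 - n%:R ^- k <= output_prob P (poly_bound c d n) A rho true) /\
        ((f n <= negativity A rho /\
          ((f n)%:E <= fidelity_of_separability A rho)%E) ->
         1 - n%:R ^- k <= output_prob P (poly_bound c d n) A rho false).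
Proof.
(* The moment is at least n^-s in case (a) and at most n^-(s + 2) in case (b). *)
pose s := Num.bound `|3 * cS + 2 * cE|.
(* The count has mean n^(e1 + e2) (1 + p4), so the threshold corresponds to the intermediate moment
   n^-e2. The surplus [k.+2] of [e1] over [e2] yields the failure probability. *)
pose e2 := s.+1; pose e1 := (e2 + k.+2)%N.
exists (pt_program e1 e2), (pt_constant e1 e2), (e1 + e2).+1; split.
  by move=> n A rho rhoD; rewrite !output_prob_walk // walk_decision.
have cs : 3 * cS + 2 * cE <= s%:R.
  by apply: le_trans (ler_norm _) _; apply/ltW/archi_boundP/normr_ge0.
near=> n => A rho rhoD S2.
have n2 : (2 <= n)%N by near: n; apply: nbhs_infty_ge.
have N2 : 2 <= n%:R :> R by rewrite ler_nat.
have N0 : 0 < n%:R :> R by lra.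
have ln0 : 0 < ln n%:R :> R by rewrite ln_gt0 //; lra.
(* The superlogarithmic growth of [f], used for the single constant [s.+2]. *)
have fn : (s.+2)%:R * ln n%:R <= f n.
  rewrite -ler_pdivlMr //; near: n.
  by move/cvgryPge : f_omega; apply.
set p4 := moment4 A rho.
have p0 : 0 <= p4 := moment4_ge0 A rhoD.
have p1 : p4 <= 1 := moment4_le1 A rhoD.
have p01 : 0 <= (1 + p4) / 2 <= 1 by apply/andP; split; lra.
have d0 : 0 < n%:R ^+ e1 / 2 :> R by rewrite divr_gt0 // exprn_gt0.
have T0 j : 0 < n%:R ^+ j :> R by rewrite exprn_gt0.
have err := trial_error N2 (erefl e1).
rewrite !output_prob_walk // -/p4; split => -[En Dn].
- have pn : n%:R ^- s <= p4.
    have [Pu0 Pu1] := andP (density_trace_sqr rhoD).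
    have H := moment4_negativity A rhoD; rewrite -/p4 in H.
    move: S2 En; rewrite /renyi2 /negativity.
    set Pu := complex.Re _ in H Pu0 Pu1 *; set tn := trace_norm _ in H *.
    move=> S2 En.
    (* The purity is positive, which forces both factors to be positive, as the rules for logarithms
       require. *)
    have tn2p4 : 0 < tn ^+ 2 * p4 by apply: lt_le_trans H; rewrite exprn_gt0.
    have p4p : 0 < p4.
      rewrite lt_neqAle p0 andbT; apply: contraTneq tn2p4 => <-.
      by rewrite mulr0 ltxx.
    have tn0 : 0 <= tn.
      rewrite /tn /trace_norm trace_sqrtmx; first by apply: sumr_ge0.
      by rewrite -{2}(trmxCK (partial_transpose A rho)); apply: psd_gram.
    have tnp : 0 < tn.
      rewrite lt_neqAle tn0 andbT; apply: contraTneq tn2p4 => <-.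
      by rewrite expr0n mul0r ltxx.
    have : ln (Pu ^+ 3) <= ln (tn ^+ 2 * p4) by rewrite ler_ln ?posrE ?exprn_gt0.
    rewrite lnM ?posrE ?exprn_gt0 // !lnXn // => lnH.
    rewrite -ler_ln ?posrE ?invr_gt0 // lnV ?posrE // lnXn //.
    rewrite -[ln n%:R *+ s]mulr_natl.
    rewrite -[ln Pu *+ 3]mulr_natl -[ln tn *+ 2]mulr_natl in lnH.
    have : (3 * cS + 2 * cE) * ln n%:R <= s%:R * ln n%:R by rewrite ler_pM2r.
    rewrite mulrDl -!mulrA => cL.
    by lra.
  apply: le_trans (walk_chebyshev p01 d0 _); first by rewrite lerD2l lerN2 natrX.
  have : n%:R ^+ (e1 + e2) * n%:R ^- s <= n%:R ^+ (e1 + e2) * p4.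
    by rewrite ler_pM2l.
  (* The mean exceeds n^(e1 + e2) by at least n n^e1 >= 2 n^e1, while the threshold exceeds it by
     n^e1 only. *)
  have -> : n%:R ^+ (e1 + e2) * n%:R ^- s = n%:R ^+ e1 * n%:R :> R.
    by rewrite exprD (exprS _ s) -!mulrA mulfV ?mulr1 // gt_eqF.
  have := T0 e1; rewrite natrD !natrX.
  set T := n%:R ^+ (e1 + e2); set U := n%:R ^+ e1 => U0.
  have : U * 2 <= U * n%:R by rewrite ler_pM2l.
  by move=> *; lra.
have pn : p4 <= n%:R ^- s.+2.
  (* The separable state is available only for a positive moment. *)
  have [p40|p4p] := eqVneq p4 0; first by rewrite p40 invr_ge0 ltW.
  have {}p4p : 0 < p4 by rewrite lt_neqAle eq_sym p4p.
  have [sigma sep pF] := moment4_separable rhoD p4p.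
  have F0 := lt_le_trans p4p pF.
  have : ((f n)%:E <= - lne (fidelity rho sigma)%:E)%E.
    by apply: le_trans Dn _; apply: ereal_inf_lbound; exists sigma.
  rewrite lne_EFin // -EFinN lee_fin => fF.
  rewrite -ler_ln ?posrE ?invr_gt0 // lnV ?posrE // lnXn //.
  rewrite -[ln n%:R *+ _]mulr_natl.
  have : ln p4 <= ln (fidelity rho sigma) by rewrite ler_ln.
  by move=> *; lra.
apply: le_trans (walk_chebyshev p01 d0 _); first by rewrite lerD2l lerN2 natrX.
have : n%:R ^+ (e1 + e2) * p4 <= n%:R ^+ (e1 + e2) * n%:R ^- s.+2.
  by rewrite ler_pM2l.
(* Now the mean exceeds n^(e1 + e2) by at most n^e1 / n <= n^e1 / 2. The remaining distance n^e1 / 2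
   to the threshold is the deviation allowed in Chebyshev's inequality. *)
have -> : n%:R ^+ (e1 + e2) * n%:R ^- s.+2 = n%:R ^+ e1 / n%:R :> R.
  rewrite exprD (exprS _ s.+1) /e2; field.
  by rewrite ?expf_neq0 gt_eqF.
have := T0 e1; rewrite natrD !natrX.
set T := n%:R ^+ (e1 + e2); set U := n%:R ^+ e1 => U0.
have : U / n%:R <= U / 2 by rewrite ler_pM2l // lef_pV2 ?posrE.
by move=> *; lra.
Unshelve. all: by end_near.
Qed.
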